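(* Let $\mathsf S$ be a simple polytope and let $\mathrm B$ be a building set for $\mathsf S$. The open polyhedral cones $\mathcal T_{\mathscr A_{\mathrm B}}(\mathsf S)$ and $\mathcal T_{\mathrm B}(\mathsf S)$ have full-dimensional intersection.
   Context: Conventions. Let $\Lambda$ be a lattice (by default $\mathbb Z^n\subset\mathbb R^n$) and $V=\Lambda\otimes\mathbb R$. Polytopes live in $V$; normal vectors live in $V^*$, which contains the dual lattice $\Lambda^*$ (for $\mathbb R^n$ identified via the dot product). All polytopes have rational facet normals. $h(\mathsf P,u)=\min_{x\in\mathsf P}u\cdot x$. The normal fan $\Sigma(\mathsf P)$ is the collection of normal cones $\{u : u\cdot x=h(\mathsf P,u)\ \forall x\in\mathsf F\}$ of nonempty faces $\mathsf F$; its lineality space is $\{w : w\cdot x\text{ constant on }\mathsf P\}$. A fan coarsens another if each of its cones is a union of cones of the other. Face normals. For a facet $\mathsf G$ of $\mathsf S$, $u_{\mathsf G}\in\Lambda^*$ is a fixed inner normal whose image in the quotient of $\Lambda^*$ by its intersection with the lineality space of $\Sigma(\mathsf S)$ is primitive; for a nonempty proper face $\mathsf F$, $u_{\mathsf F}=\sum_{\mathsf G\supseteq\mathsf F}u_{\mathsf G}$ over the facets containing $\mathsf F$. Truncations. $\operatorname{Tr}_\epsilon[\mathsf S,\mathsf F]=\{x\in\mathsf S : u_{\mathsf F}\cdot x\ge h(\mathsf S,u_{\mathsf F})+\epsilon\}$. Let $\delta_{\mathsf F}=\min_y(u_{\mathsf F}\cdot y-h(\mathsf S,u_{\mathsf F}))$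 over vertices $y\notin\mathsf F$ joined by an edge to a vertex of $\mathsf F$. The truncation is shallow if $0<\epsilon<\delta_{\mathsf F}$; the deep truncation is $\operatorname{DTr}[\mathsf S,\mathsf F]=\operatorname{Tr}_{\delta_{\mathsf F}}[\mathsf S,\mathsf F]$. Building sets. A set $\mathrm B$ of nonempty proper faces of a simple polytope $\mathsf S$ is a building set for $\mathsf S$ if (1) it contains all facets; (2) whenever $\mathsf F,\mathsf G\in\mathrm B$ satisfy $\mathsf F\cap\mathsf G\ne\emptyset$ and some facet contains both, then $\mathsf F\cap\mathsf G\in\mathrm B$. $\mathrm B$-truncation. List $\mathrm B$ as $\mathsf F_1,\dots,\mathsf F_m$ in an order extending inclusion (smaller faces first), let $\mathsf S_0=\mathsf S$, and for numbers $\epsilon_{\mathsf F}>0$ let $\mathsf S_i=\operatorname{Tr}_{\epsilon_{\mathsf F_i}}[\mathsf S_{i-1},\mathsf F_i\cap\mathsf S_{i-1}]$ (direction $u_{\mathsf F_i}$). If each truncation is shallow, $\mathsf S_m$ is a $\mathrm B$-truncation of $\mathsf S$. All $\mathrm B$-truncations of $\mathsf S$ have the same normal fan, denoted $\Gamma_{\mathrm B}$. The cones. Polytopes are identified with their support functions, and Minkowski sums with sums. $\operatorname{PL}(\Gamma_{\mathrm B})$ is the vector space of functions on $V^*$ linear on each cone of $\Gamma_{\mathrm B}$; $\operatorname{Def}(\Gamma_{\mathrm B})\subseteq\operatorname{PL}(\Gamma_{\mathrm B})$ is the cone of support functions of polytopes whose normal fan coarsens $\Gamma_{\mathrm B}$.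 Then $\mathcal T_{\mathrm B}(\mathsf S)=\{\lambda\mathsf P+v : \lambda>0,\ v\in V,\ \mathsf P\text{ a }\mathrm B\text{-truncation of }\mathsf S\}$, and $\mathcal T_{\mathscr A_{\mathrm B}}(\mathsf S)=\{c\,\mathsf S+\sum_{\mathsf F\in\mathrm B}c_{\mathsf F}\operatorname{DTr}[\mathsf S,\mathsf F]+v : c>0,\ c_{\mathsf F}>0\ \forall\mathsf F\in\mathrm B,\ v\in V\}$, both subsets of $\operatorname{Def}(\Gamma_{\mathrm B})$. Full-dimensional means full-dimensional in $\operatorname{PL}(\Gamma_{\mathrm B})$. *)

(* Defs.v *)
From HB Require Import structures.
From mathcomp Require Import all_boot all_order all_algebra.
From mathcomp Require Import all_classical all_reals.

Set Implicit Arguments.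
Unset Strict Implicit.
Unset Printing Implicit Defensive.

Import Order.TTheory GRing.Theory Num.Theory.

Local Open Scope classical_set_scope.
Local Open Scope ring_scope.

(* The lattice is Z^n in V = R^n; both V and its
   dual V^* are 'rV[R]_n, paired by the dot product. Polytopes, faces and cones
   are sets of vectors. *)

Section Polytopes.
Context {R : realType} {n : nat}.
Local Notation V := 'rV[R]_n.
Implicit Types (P F G E C : set V) (u v w x y : V).

Definition dot u x : R := \sum_(i < n) u 0 i * x 0 i.

Definition integral u : Prop := u \is a mxOver (Num.int : {pred R}).

Definition conv (k : nat) (p : 'I_k -> V) : set V :=
  [set x | exists a : 'I_k -> R, [/\ forall i, 0 <= a i, \sum_i a i = 1
                                   & x = \sum_i a i *: p i]].

Definition polytope P : Prop :=
  exists (k : nat) (p : 'I_k.+1 -> V), P = conv p.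

(* The infimum is attained when P is a polytope. *)
Definition support P u : R := inf [set dot u x | x in P].

Definition in_flat P (d : nat) : Prop :=
  exists v (W : {vspace V}), \dim W = d /\ forall x, P x -> x - v \in W.

Lemma in_flat_ex P : exists d, `[< in_flat P d >].
Proof.
exists (\dim (fullv : {vspace V})); apply/asboolP; exists 0, fullv.
by split=> // x _; rewrite memvf.
Qed.

(* Least dimension of an affine subspace containing P (0 if P is empty). *)
Definition adim P : nat := ex_minn (in_flat_ex P).

(* Nonempty faces, P included (u = 0). *)
Definition face P F : Prop :=
  exists u, F = [set x | P x /\ dot u x = support P u].

Definition proper_face P F : Prop := face P F /\ F <> P.

Definition facet P F : Prop := face P F /\ (adim F).+1 = adim P.

Definition edge P F : Prop := face P F /\ adim F = 1%N.

Definition vertex P x : Prop := face P [set x].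

Definition simple_polytope P : Prop :=
  polytope P /\
  forall x, vertex P x -> ([set G | facet P G /\ G x] #= `I_(adim P))%card.

Definition normal_cone P F : set V :=
  [set u | forall x, F x -> dot u x = support P u].

Definition normal_fan P : set (set V) :=
  [set C | exists F, face P F /\ C = normal_cone P F].

(* The lineality space of the normal fan of P. *)
Definition lineality P : set V :=
  [set w | forall x y, P x -> P y -> dot w x = dot w y].

(* nu G is an inner normal of G in Z^n whose class modulo Z^n `&` lineality P
   is primitive: the case k = 0 says that the class is nonzero, the cases k > 1
   that it is not a proper multiple. *)
Definition primitive_normal P G u : Prop :=
  [/\ integral u,
      G = [set x | P x /\ dot u x = support P u] &
      forall (k : nat) w l, integral w -> integral l -> lineality P l ->
        u = w *+ k + l -> k = 1%N].

Definition facet_normals P (nu : set V -> V) : Prop :=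
  forall G, facet P G -> primitive_normal P G (nu G).

Definition face_normal P (nu : set V -> V) F : V :=
  \sum_(G \in [set G | facet P G /\ F `<=` G]) nu G.

(* Truncations of P at a face F, in a prescribed direction u that attains its
   minimum over P on F. *)
Definition Tr (eps : R) P u : set V :=
  [set x | P x /\ support P u + eps <= dot u x].

Definition joined P x y : Prop := exists E, [/\ edge P E, E x & E y].

(* A minimum over a finite set, nonempty when F is a nonempty proper face of a
   polytope P. If there is no such vertex the value is 0, so that no truncation
   is shallow. *)
Definition delta P F u : R :=
  inf [set dot u y - support P u | y in
        [set y | [/\ vertex P y, ~ F y &
                     exists x, [/\ vertex P x, F x & joined P x y]]]].

Definition shallow (eps : R) P F u : Prop := 0 < eps < delta P F u.

Definition DTr P F u : set V := Tr (delta P F u) P u.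

Section Cones.
Variables (S : set V) (nu : set V -> V) (B : set (set V)).
Local Notation u_ F := (face_normal S nu F).

Definition building_set : Prop :=
  [/\ forall F, B F -> proper_face S F,
      forall G, facet S G -> B G &
      forall F G, B F -> B G -> F `&` G !=set0 ->
        (exists H, [/\ facet S H, F `<=` H & G `<=` H]) -> B (F `&` G)].

Definition inclusion_listing (s : seq (set V)) : Prop :=
  [/\ uniq s, [set` s] = B &
      forall i j, (i < size s)%N -> (j < size s)%N ->
        nth set0 s i `<` nth set0 s j -> (i < j)%N].

Fixpoint truncate (eps : set V -> R) P (s : seq (set V)) : set V :=
  if s is F :: s' then truncate eps (Tr (eps F) P (u_ F)) s' else P.

Fixpoint all_shallow (eps : set V -> R) P (s : seq (set V)) : Prop :=
  if s is F :: s' then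
    shallow (eps F) P (F `&` P) (u_ F) /\
    all_shallow eps (Tr (eps F) P (u_ F)) s'
  else True.

Definition truncation : set (set V) :=
  [set P | exists (s : seq (set V)) (eps : set V -> R),
     [/\ inclusion_listing s, all_shallow eps S s & P = truncate eps S s]].

(* All B-truncations of S have the same normal fan; Gamma is the normal fan of
   an unspecified one of them. *)
Definition Gamma : set (set V) := normal_fan (xget set0 truncation).

(* Polytopes are identified with their support functions V^* -> R, a vector v
   of V with the linear function dot^~ v, and Minkowski sums with sums. *)
Definition T_trunc : set (V -> R) :=
  [set f | exists (c : R) P v, [/\ 0 < c, truncation P &
     f = fun u => c * support P u + dot u v]].

Definition T_deep : set (V -> R) :=
  [set f | exists (c : R) (cF : set V -> R) v,
     [/\ 0 < c, forall F, B F -> 0 < cF F &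
      f = fun u => c * support S u
                   + \sum_(F \in B) cF F * support (DTr S F (u_ F)) u
                   + dot u v]].

End Cones.

Definition PL (Sigma : set (set V)) : set (V -> R) :=
  [set f | forall C, Sigma C -> exists x, forall u, C u -> f u = dot u x].

(* X has nonempty interior in the space U. For U = PL Sigma with Sigma a
   complete fan, U is finite-dimensional and the supremum over the cube
   [-1, 1]^n is a norm on it, as its elements are positively homogeneous. *)
Definition full_dimensional (U X : set (V -> R)) : Prop :=
  X `<=` U /\
  exists (f : V -> R) (e : R), [/\ X f, 0 < e &
    forall g, U g ->
      (forall u, (forall i, `|u 0 i| <= 1) -> `|g u - f u| < e) -> X g].

End Polytopes.

(* Main.v *)
(** In slack coordinates the truncation at a face [F] is
    [s_F >= eps F], where [s_F] is the sum of the slacks of the facets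
    containing [F]. Shallowness of every step amounts to a gap at the vertices
    ([gapped]), and it keeps the polytopes simple. In simple polytopes tight
    constraints can be released one at a time, so one can push a point of a
    truncation back to the earlier ones and see that the faces whose
    constraints are tight at a point form a nested set, and conversely that
    every nested set is tight at some point of every [B]-truncation. Hence all
    [B]-truncations have the same normal cones, spanned by the [u_F] of nested
    sets and the lineality space, and an element of [PL] is determined by its
    values there.
    The deep truncation at [I] attains simultaneously its minima in the
    directions of a nested set, and [h(DTr I, u_J) - h(S, u_J)] is [delta_I] if
    [J] is contained in [I] and 0 otherwise. So [S] truncated at depths [eps]
    is in the deep cone as soon as the triangular system
    [eps J = \sum_(I containing J) c_I delta_I] has a positive solution with
    [\sum_I c_I < 1]. Choosing the depths one after the other, each much
    smaller than the previous ones, gives a whole box of depths which are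
    shallow and for which this holds; the box parametrizes, up to translations,
    an open subset of [PL]. *)

Require Import Defs.
From mathcomp Require Import all_boot all_order all_algebra.
From mathcomp Require Import all_classical all_reals.
From mathcomp Require Import lra ring.

Set Implicit Arguments.
Unset Strict Implicit.
Unset Printing Implicit Defensive.

(* Defs again: ssralg shadows [support]. *)
Import Order.TTheory GRing.Theory Num.Theory Defs.

Local Open Scope classical_set_scope.
Local Open Scope ring_scope.

(** * Finite minima *)

(** At [u_J], the function [c S + \sum_I c_I DTr I] takes the value [(c + \sum_I c_I) h(S, u_J)]
    plus the sum of [c_I delta_I] over the [I] containing [J]. Comparing with [h(S, u_J) + eps J]
    gives the triangular system and forces [c = 1 - \sum_I c_I], whence the bound on the sum.
    Positivity of the solution asks the depth of a face to exceed what the larger faces contribute: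
    small faces, cut first, are cut deepest. The obstacle is that shallowness is measured on the
    polytope already truncated, through its vertices and edges. The invariant that controls these is
    the linear independence of the tight normals: it yields dual vectors, and from them edges,
    feasible directions and multipliers by linear algebra. Since [Gamma] is the fan of an
    unspecified truncation, its cones are not enumerated; linearity on them is derived from minima
    that a polytope attains simultaneously. *)

Section FiniteMinima.
Context {R : realType}.

Lemma seq_eps (T : eqType) (s : seq T) (A : T -> R -> Prop) :
  (forall p, p \in s -> exists2 e, 0 < e & forall t, 0 <= t <= e -> A p t) ->
  exists2 e, 0 < e & forall p t, p \in s -> 0 <= t <= e -> A p t.
Proof.
elim: s => [|a s IH] H; first by exists 1.
have [e1 e1_gt0 H1] := H a (mem_head _ _).
have [|e2 e2_gt0 H2] := IH.
  by move=> p ps; apply: H; rewrite inE ps orbT.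
exists (Num.min e1 e2); first by rewrite lt_min e1_gt0.
move=> p t; rewrite inE le_min => /orP[/eqP->|ps] /and3P[t0 t1 t2].
  by apply: H1; rewrite t0.
by apply: H2; rewrite ?t0.
Qed.

Lemma seq_argmin (T : eqType) (s : seq T) (f : T -> R) : s != [::] ->
  exists2 p, p \in s & forall q, q \in s -> f p <= f q.
Proof.
elim: s => // a [|b s] IH _.
  by exists a; rewrite ?mem_head // => q; rewrite inE => /eqP->.
have [p ps pmin] := IH isT.
have [le_ap|/ltW le_pa] := leP (f a) (f p).
  exists a; first by rewrite mem_head.
  move=> q; rewrite inE => /orP[/eqP->//|/pmin]; exact: le_trans.
exists p; first by rewrite inE ps orbT.
by move=> q; rewrite inE => /orP[/eqP->//|/pmin].
Qed.

Lemma finite_argmin (T : finType) (Y : Type) (X : set Y) (k : Y -> T)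
    (f : Y -> R) :
  (forall y z, X y -> X z -> k y = k z -> f y = f z) -> X !=set0 ->
  exists2 y, X y & forall z, X z -> f y <= f z.
Proof.
move=> kf [x Xx].
suff H : forall e : seq T, (exists2 y, X y & k y \in e) ->
    exists2 y, X y & forall z, X z -> k z \in e -> f y <= f z.
  have [|y Xy ymin] := H (enum T); first by exists x; rewrite ?mem_enum.
  by exists y => // z Xz; apply: ymin; rewrite ?mem_enum.
elim=> [[]//|a e IH] [y Xy ky].
have [[y' Xy' ky']|none] := pselect (exists2 y, X y & k y \in e); last first.
  exists y => // z Xz; rewrite inE => /orP[/eqP kz|kz]; last first.
    by case: none; exists z.
  move: ky; rewrite inE => /orP[/eqP ky|ky]; last by case: none; exists y.
  by rewrite (kf y z) // ky kz.
have [|m Xm mmin] := IH; first by exists y'.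
have [[z [Xz kz lt_zm]]|none] := pselect (exists z, [/\ X z,
  k z = a & f z < f m]).
  exists z => // z' Xz'; rewrite inE => /orP[/eqP kz'|kz'].
    by rewrite (kf z z') // kz kz'.
  exact: le_trans (ltW lt_zm) (mmin _ Xz' kz').
exists m => // z Xz; rewrite inE => /orP[/eqP kz|]; last exact: mmin.
by rewrite leNgt; apply/negP => lt_zm; apply: none; exists z.
Qed.

Lemma count_lt (T : eqType) (s : seq T) (a b : pred T) p :
  p \in s -> b p -> ~~ a p -> {in s, forall q, a q -> b q} ->
  (count a s < count b s)%N.
Proof.
move=> + bp nap; elim: s => //= q s IH; rewrite inE => /orP[/eqP<-|ps] ab.
  rewrite bp (negPf nap) add0n add1n ltnS; elim: s {IH} ab => //= r s IH ab.
  apply: leq_add; last first.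
    by apply: IH => z; rewrite inE => /orP[/eqP->|zs]; apply: ab;
      rewrite !inE ?eqxx ?zs ?orbT.
  have: a r -> b r by apply: ab; rewrite !inE eqxx orbT.
  by case: (a r) => // ->.
rewrite -addnS; apply: leq_add.
  by have := ab q (mem_head _ _); case: (a q) => // ->.
by apply: IH => // z zs; apply: ab; rewrite inE zs orbT.
Qed.

End FiniteMinima.

Section Dot.
Context {R : realType} {n : nat}.
Implicit Types (u v w x y : 'rV[R]_n).

Lemma dotC u x : dot u x = dot x u.
Proof. by apply: eq_bigr => i _; rewrite mulrC. Qed.

Lemma dotDr u x y : dot u (x + y) = dot u x + dot u y.
Proof. by rewrite -big_split; apply: eq_bigr => i _; rewrite mxE mulrDr. Qed.

Lemma dotZr u a x : dot u (a *: x) = a * dot u x.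
Proof. by rewrite big_distrr; apply: eq_bigr => i _; rewrite mxE mulrCA. Qed.

Lemma dotNr u x : dot u (- x) = - dot u x.
Proof. by rewrite -scaleN1r dotZr mulN1r. Qed.

Lemma dotBr u x y : dot u (x - y) = dot u x - dot u y.
Proof. by rewrite dotDr dotNr. Qed.

Lemma dot0r u : dot u 0 = 0.
Proof. by rewrite -(scale0r 0) dotZr mul0r. Qed.

Lemma dot_sumr u I (s : seq I) (P : pred I) (F : I -> 'rV[R]_n) :
  dot u (\sum_(i <- s | P i) F i) = \sum_(i <- s | P i) dot u (F i).
Proof. by apply: (big_morph _ (dotDr u) (dot0r u)). Qed.

Lemma dotDl u v x : dot (u + v) x = dot u x + dot v x.
Proof. by rewrite !(dotC _ x) dotDr. Qed.

Lemma dotZl a u x : dot (a *: u) x = a * dot u x.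
Proof. by rewrite !(dotC _ x) dotZr. Qed.

Lemma dotNl u x : dot (- u) x = - dot u x.
Proof. by rewrite !(dotC _ x) dotNr. Qed.

Lemma dotBl u v x : dot (u - v) x = dot u x - dot v x.
Proof. by rewrite !(dotC _ x) dotBr. Qed.

Lemma dot_suml x I (s : seq I) (P : pred I) (F : I -> 'rV[R]_n) :
  dot (\sum_(i <- s | P i) F i) x = \sum_(i <- s | P i) dot (F i) x.
Proof. by rewrite dotC dot_sumr; apply: eq_bigr => i _; rewrite dotC. Qed.

Lemma dotvv_gt0 v : v != 0 -> 0 < dot v v.
Proof.
move=> v0; have ge0 i : 0 <= v 0 i * v 0 i by rewrite -expr2 sqr_ge0.
rewrite lt_neqAle sumr_ge0 // andbT eq_sym.
apply: contra_neqN v0 => /eqP /psumr_eq0P H.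
apply/rowP => i; rewrite mxE; apply/eqP.
by have /eqP := H (fun i _ => ge0 i) i isT; rewrite mulf_eq0 orbb.
Qed.

Lemma dot_delta u i : dot (delta_mx 0 i) u = u 0 i.
Proof.
rewrite /dot (bigD1 i) //= mxE !eqxx mul1r big1 ?addr0 // => j ji.
by rewrite mxE (negPf ji) andbF mul0r.
Qed.

Lemma support_argmin (P : set 'rV[R]_n) u y :
  P y -> (forall x, P x -> dot u y <= dot u x) -> support P u = dot u y.
Proof.
move=> Py ymin; apply/eqP; rewrite eq_le; apply/andP; split.
  by apply: ge_inf; [exists (dot u y) => _ [x Px <-]; exact: ymin | exists y].
apply: lb_le_inf; first by exists (dot u y), y.
by move=> _ [x Px <-]; exact: ymin.
Qed.

Lemma adimE (P : set 'rV[R]_n) (U : {vspace 'rV[R]_n}) y :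
  (forall x, P x -> x - y \in U) ->
  (forall U' : {vspace 'rV[R]_n}, (forall x z, P x -> P z -> x - z \in U') ->
     (U <= U')%VS) ->
  adim P = \dim U.
Proof.
move=> PU Umin; rewrite /adim.
case: ex_minnP => m /asboolP [v [U' [<- PU']]] mmin.
apply/eqP; rewrite eqn_leq; apply/andP; split.
  by apply: mmin; apply/asboolP; exists y, U.
apply: dimvS; apply: Umin => x z Px Pz.
have -> : x - z = (x - v) - (z - v) by rewrite opprB addrA subrK.
by rewrite rpredB // PU'.
Qed.

End Dot.

(** * Polyhedra given by inequalities *)

Section HPolyhedra.
Context {R : realType} {n : nat}.
Local Notation V := 'rV[R]_n.
Context (W : {vspace V}) (o : V).
Implicit Types (u v w x y z : V) (p q : V * R) (D : seq (V * R)).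

(** The affine hull [o + W] is kept apart from the inequalities, since an equation written as two
    opposite inequalities would destroy the independence of the tight normals. *)
Definition hpoly D : set V :=
  [set x | x - o \in W /\ forall p, p \in D -> p.2 <= dot p.1 x].

Definition act x p := dot p.1 x == p.2.

(* Linear independence modulo the orthogonal of W of the normals of the
   constraints active at x, in dual form: their values can be prescribed. *)
Definition nondeg D x := forall t : V * R -> R, exists2 v, v \in W &
  forall p, p \in D -> act x p -> dot p.1 v = t p.

Definition hvertex D x := hpoly D x /\
  forall v, v \in W -> (forall p, p \in D -> act x p -> dot p.1 v = 0) -> v = 0.

(** Boundedness in the form that shooting a ray requires; it passes to subsets. *)
Definition ray_free (P : set V) := forall x v, P x -> v != 0 ->
  exists2 t, 0 <= t & ~ P (x + t *: v).

Lemma dot_lin u x t v : dot u (x + t *: v) = dot u x + t * dot u v.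
Proof. by rewrite dotDr dotZr. Qed.

Lemma hpoly_diff D x y : hpoly D x -> hpoly D y -> x - y \in W.
Proof.
move=> [xW _] [yW _].
have -> : x - y = (x - o) - (y - o) by rewrite opprB addrA subrK.
exact: rpredB.
Qed.

Lemma hpoly_convex D x y t : hpoly D x -> hpoly D y -> 0 <= t <= 1 ->
  hpoly D (x + t *: (y - x)).
Proof.
move=> Dx Dy /andP[t0 t1]; split.
  have yx := hpoly_diff Dy Dx; case: Dx => xW _.
  by rewrite addrAC rpredD // rpredZ.
move=> p pD; rewrite dot_lin dotBr.
have := Dx.2 p pD; have := Dy.2 p pD; nra.
Qed.

Lemma hpoly_step D x v : hpoly D x -> v \in W ->
  (forall p, p \in D -> act x p -> 0 <= dot p.1 v) ->
  exists2 e, 0 < e & forall t, 0 <= t <= e -> hpoly D (x + t *: v).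
Proof.
move=> Dx vW H.
have [|e e_gt0 He] := @seq_eps R _ D (fun p t => p.2 <= dot p.1 (x + t *: v)).
  move=> p pD; have xp := Dx.2 p pD.
  have [v_ge0|v_lt0] := leP 0 (dot p.1 v).
    by exists 1 => // t /andP[t0 _]; rewrite dot_lin; nra.
  exists ((dot p.1 x - p.2) / - dot p.1 v).
    rewrite divr_gt0 ?oppr_gt0 // subr_gt0 lt_neqAle xp andbT eq_sym.
    by apply: contraTneq v_lt0 => /eqP/(H p pD); rewrite leNgt.
  move=> t /andP[t0]; rewrite ler_pdivlMr ?oppr_gt0 // dot_lin; lra.
exists e => // t te; split; last by move=> p pD; exact: He.
by case: Dx => xW _; rewrite addrAC rpredD // rpredZ.
Qed.

(** Ratio test: [r p] is the time at which the ray meets the constraint [p], and the least one among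
    the decreasing constraints is the exit time. Without rays, some constraint must decrease. *)
Lemma hpoly_exit D x v : hpoly D x -> ray_free (hpoly D) -> v \in W ->
  v != 0 -> (forall p, p \in D -> act x p -> 0 <= dot p.1 v) ->
  exists t p, [/\ 0 < t, hpoly D (x + t *: v), p \in D, dot p.1 v < 0 &
    act (x + t *: v) p].
Proof.
move=> Dx ray vW v0 H.
pose r p := (dot p.1 x - p.2) / - dot p.1 v.
have [|p] := @seq_argmin R _ [seq p <- D | dot p.1 v < 0] r.
  apply/eqP => Dv; have [t t0] := ray x v Dx v0; apply; split.
    by case: Dx => xW _; rewrite addrAC rpredD // rpredZ.
  move=> p pD; rewrite dot_lin; have := Dx.2 p pD.
  suff : 0 <= dot p.1 v by nra.
  rewrite leNgt; apply/negP => v_lt0.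
  have : p \in [seq p <- D | dot p.1 v < 0] by rewrite mem_filter v_lt0.
  by rewrite Dv.
rewrite mem_filter => /andP[v_lt0 pD] rmin.
have rv q : dot q.1 v < 0 -> r q * - dot q.1 v = dot q.1 x - q.2.
  by move=> qv; rewrite divfK // oppr_eq0 lt_eqF.
have r_gt0 : 0 < r p.
  rewrite divr_gt0 ?oppr_gt0 // subr_gt0 lt_neqAle Dx.2 // andbT eq_sym.
  by apply: contraTneq v_lt0 => /eqP/(H p pD); rewrite leNgt.
exists (r p), p; split=> //; last first.
  by rewrite /act dot_lin; have := rv p v_lt0; move=> ?; apply/eqP; lra.
split; first by case: Dx => xW _; rewrite addrAC rpredD // rpredZ.
move=> q qD; rewrite dot_lin; have := Dx.2 q qD.
have [qv|qv] := leP 0 (dot q.1 v); first by nra.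
have := rmin q; rewrite mem_filter qv qD => /(_ isT).
by have := rv q qv; nra.
Qed.

(** As long as [x] is not a vertex, some line through it keeps the active constraints active;
    following it in the sense in which [u] does not increase activates one more. Hence the walk
    never leaves a face cut out by active constraints of [x]. *)
Lemma hpoly_walk D x u : hpoly D x -> ray_free (hpoly D) ->
  exists y, [/\ hvertex D y, dot u y <= dot u x &
    forall p, p \in D -> act x p -> act y p].
Proof.
move=> + ray.
have [m] := ubnP (count (fun p => ~~ act x p) D).
elim: m x => // m IH x; rewrite ltnS => le_m Dx.
have [xvert|notvert] := pselect (hvertex D x); first by exists x.
have [v [vW v0 uv Hv]] : exists v, [/\ v \in W, v != 0, dot u v <= 0 &
    forall p, p \in D -> act x p -> dot p.1 v = 0].
  have [v [vW v0 Hv]] : exists v, [/\ v \in W, v != 0 &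
      forall p, p \in D -> act x p -> dot p.1 v = 0].
    apply: contrapT => none; apply: notvert; split=> // v vW Hv.
    by apply/eqP/negPn/negP => v0; apply: none; exists v.
  have [uv|/ltW uv] := leP (dot u v) 0; first by exists v.
  exists (- v); split; rewrite ?rpredN ?oppr_eq0 //.
    by rewrite dotNr oppr_le0.
  by move=> p pD xp; rewrite dotNr Hv ?oppr0.
have [|t [p [t0 Dx' pD pv px']]] := hpoly_exit Dx ray vW v0.
  by move=> p pD xp; rewrite Hv.
have keep q : q \in D -> act x q -> act (x + t *: v) q.
  by move=> qD xq; rewrite /act dot_lin Hv // mulr0 addr0.
have [|//|y [yvert uy Hy]] := IH (x + t *: v).
  apply: leq_trans le_m; apply: (@count_lt _ _ _ _ p) => //=.
  - by apply: contraTN pv => xp; rewrite Hv ?ltxx.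
  - by rewrite negbK.
  - by move=> q qD; apply: contraNN; exact: keep.
exists y; split=> //; last by move=> q qD xq; apply/Hy/keep.
by apply: le_trans uy _; rewrite dot_lin; nra.
Qed.

Lemma hvertex_inj D y z : hvertex D y -> hvertex D z ->
  (forall p, p \in D -> act y p -> act z p) -> y = z.
Proof.
move=> [Dy yv] [Dz _] yz; apply/eqP; rewrite -subr_eq0; apply/eqP.
apply: yv (hpoly_diff Dy Dz) _ => p pD yp.
by rewrite dotBr (eqP yp) (eqP (yz p pD yp)) subrr.
Qed.

(** A vertex is determined by its active constraints, and these form a finite key. *)
Lemma hvertex_argmin D (X : set V) (f : V -> R) :
  X `<=` hvertex D -> X !=set0 -> exists2 y, X y & forall z, X z -> f y <= f z.
Proof.
move=> XD; apply: (@finite_argmin _ _ _ _ (fun y =>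
  [tuple of map (act y) (in_tuple D)])).
move=> y z /XD yv /XD zv /(congr1 val) /= /eq_in_map yz; congr f.
by apply: (hvertex_inj yv zv) => p pD yp; rewrite -yz.
Qed.

Lemma hpoly_min D x u : hpoly D x -> ray_free (hpoly D) ->
  exists2 y, hvertex D y & forall z, hpoly D z -> dot u y <= dot u z.
Proof.
move=> Dx ray.
have [x' [x'v _ _]] := hpoly_walk u Dx ray.
have [//||y yv ymin] := @hvertex_argmin D (hvertex D) (dot u).
  by exists x'.
exists y => // z Dz; have [z' [z'v le_z _]] := hpoly_walk u Dz ray.
exact: le_trans (ymin _ z'v) le_z.
Qed.

(* The sum of the normals of a set A of constraints attains the sum of their
   bounds exactly where all of A is active, which makes that set a face. *)
Lemma sum_act_ge D (A : pred (V * R)) x : hpoly D x ->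
  \sum_(p <- D | A p) p.2 <= dot (\sum_(p <- D | A p) p.1) x.
Proof.
move=> Dx; rewrite dot_suml big_seq_cond [leRHS]big_seq_cond.
by apply: ler_sum => p /andP[pD _]; exact: Dx.2.
Qed.

Lemma sum_act_eq D (A : pred (V * R)) x : hpoly D x ->
  dot (\sum_(p <- D | A p) p.1) x = \sum_(p <- D | A p) p.2 <->
  (forall p, p \in D -> A p -> act x p).
Proof.
move=> Dx; rewrite dot_suml; split=> [eqx|xA]; last first.
  rewrite big_seq_cond [RHS]big_seq_cond; apply: eq_bigr => p /andP[pD Ap].
  exact/eqP/xA.
have : \sum_(p <- D | A p) (dot p.1 x - p.2) = 0.
  by rewrite big_split /= sumrN eqx subrr.
have ge0 p : p \in D -> 0 <= dot p.1 x - p.2.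
  by move=> pD; rewrite subr_ge0 Dx.2.
elim: D {Dx eqx} ge0 => // q D IH ge0 + p; rewrite big_cons.
have ge0D p' : p' \in D -> 0 <= dot p'.1 x - p'.2.
  by move=> p'D; apply: ge0; rewrite inE p'D orbT.
have sum_ge0 : 0 <= \sum_(j <- D | A j) (dot j.1 x - j.2).
  by rewrite big_seq_cond; apply: sumr_ge0 => j /andP[/ge0D].
have q_ge0 := ge0 q (mem_head _ _).
case: ifP => Aq s0; rewrite inE => /orP[/eqP->|pD] Ap.
- by rewrite /act -subr_eq0; apply/eqP; lra.
- by apply: IH => //; lra.
- by rewrite Aq in Ap.
- exact: IH.
Qed.

Lemma hface D (A : pred (V * R)) z : hpoly D z ->
  (forall p, p \in D -> A p -> act z p) ->
  face (hpoly D) [set x | hpoly D x /\ forall p, p \in D -> A p -> act x p].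
Proof.
move=> Dz zA; pose u := \sum_(p <- D | A p) p.1.
have suppE : support (hpoly D) u = \sum_(p <- D | A p) p.2.
  have uz := (sum_act_eq A Dz).2 zA.
  by rewrite (support_argmin Dz) // => x Dx; rewrite uz sum_act_ge.
exists u; rewrite suppE; apply/seteqP.
by split=> x [Dx] /(sum_act_eq A Dx).
Qed.

Lemma hvertexP D x : ray_free (hpoly D) ->
  vertex (hpoly D) x <-> hvertex D x.
Proof.
move=> ray; split=> [[u ux]|[Dx xv]]; last first.
  have [] := @hface D (act x) x Dx (fun p _ => id) => u Hu; exists u.
  rewrite -Hu; apply/seteqP; split=> [_ ->//|y [Dy yx]] /=.
  apply/eqP; rewrite -subr_eq0; apply/eqP.
  apply: xv (hpoly_diff Dy Dx) _ => p pD xp.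
  by rewrite dotBr (eqP xp) (eqP (yx p pD xp)) subrr.
have [Dx xu] : hpoly D x /\ dot u x = support (hpoly D) u.
  by have : [set x] x by []; rewrite ux.
have [y [Dy yv] ymin] := hpoly_min u Dx ray.
rewrite (support_argmin Dy ymin) in ux xu.
split=> // v vW Hv; apply/eqP/negPn/negP => v0.
have [|e1 e1_gt0 H1] := hpoly_step Dx vW; first by move=> p pD xp; rewrite Hv.
have [||e2 e2_gt0 H2] := @hpoly_step D x (- v) Dx; first by rewrite rpredN.
  by move=> p pD xp; rewrite dotNr Hv ?oppr0.
have D1 := H1 e1; rewrite lexx ltW // in D1.
have D2 := H2 e2; rewrite lexx ltW // in D2.
have := ymin _ (D1 isT); have := ymin _ (D2 isT).
rewrite !dot_lin xu dotNr => le1 le2.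
have uv : dot u v = 0 by nra.
have : [set x] (x + e1 *: v).
  by rewrite ux; split; rewrite ?dot_lin ?uv ?mulr0 ?addr0 //; exact: D1.
move/eqP; rewrite -subr_eq0 addrC addKr scaler_eq0 (negPf v0) orbF.
by rewrite gt_eqF.
Qed.

(** At a vertex these are the edge directions: [e p] leaves the constraint [p] and stays on the
    other active ones. *)
Lemma dual_vectors D x : nondeg D x -> exists e : V * R -> V,
  forall p, e p \in W /\
    forall q, q \in D -> act x q -> dot q.1 (e p) = (q == p)%:R.
Proof.
move=> nd; have [|e He] := @choice (V * R)%type V (fun p v => v \in W /\
    forall q, q \in D -> act x q -> dot q.1 v = (q == p)%:R).
  by move=> p; have [v vW Hv] := nd (fun q => (q == p)%:R); exists v.
by exists e.
Qed.

Lemma dual_residue D x (e : V * R -> V) v :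
  (forall p, e p \in W /\
    forall q, q \in D -> act x q -> dot q.1 (e p) = (q == p)%:R) ->
  v \in W ->
  let r := v - \sum_(p <- undup D | act x p) dot p.1 v *: e p in
  r \in W /\ forall q, q \in D -> act x q -> dot q.1 r = 0.
Proof.
move=> He vW r; split.
  by rewrite rpredB // rpred_sum // => p _; rewrite rpredZ // (He p).1.
move=> q qD xq; rewrite dotBr dot_sumr -big_filter.
rewrite (bigD1_seq q) ?filter_uniq ?undup_uniq //=; last first.
  by rewrite mem_filter xq mem_undup.
rewrite dotZr (He q).2 // eqxx mulr1 big1_seq ?addr0 ?subrr // => p /andP[pq _].
by rewrite dotZr (He p).2 // eq_sym (negPf pq) mulr0.
Qed.

Lemma vertex_decomp D x u : hvertex D x -> nondeg D x ->
  exists (c : V * R -> R) l, (forall v, v \in W -> dot l v = 0) /\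
    u = l + \sum_(p <- undup D | act x p) c p *: p.1.
Proof.
move=> [Dx xv] nd; have [e He] := dual_vectors nd.
exists (fun p => dot u (e p)),
  (u - \sum_(p <- undup D | act x p) dot u (e p) *: p.1).
split; last by rewrite subrK.
move=> v vW; have [rW r0] := dual_residue He vW.
have := xv _ rW r0 => /(congr1 (dot u)).
rewrite dotBr dot_sumr dot0r dotBl dot_suml => r_eq.
rewrite -[RHS]r_eq; congr (_ - _).
by apply: eq_bigr => p _; rewrite dotZl dotZr mulrC.
Qed.

Lemma normal_decomp D x u : hpoly D x -> nondeg D x ->
  (forall z, hpoly D z -> dot u x <= dot u z) ->
  exists (c : V * R -> R) l, [/\ forall p, 0 <= c p,
    forall v, v \in W -> dot l v = 0 &
    u = l + \sum_(p <- undup D | act x p) c p *: p.1].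
Proof.
move=> Dx nd umin; have [e He] := dual_vectors nd.
have feas v : v \in W ->
    (forall p, p \in D -> act x p -> 0 <= dot p.1 v) -> 0 <= dot u v.
  move=> vW Hv; have [t t0 Ht] := hpoly_step Dx vW Hv.
  have := umin _ (Ht t _); rewrite lexx ltW // => /(_ isT).
  by rewrite dot_lin; nra.
exists (fun p => dot u (e p)),
  (u - \sum_(p <- undup D | act x p) dot u (e p) *: p.1).
split; last by rewrite subrK.
  by move=> p; apply: feas (He p).1 _ => q qD xq; rewrite (He p).2.
move=> v vW; have [] := dual_residue He vW; set r := (_ - _) => rW r0.
have ur : dot u r = 0.
  apply/eqP; rewrite eq_le -oppr_ge0 -dotNr !feas ?rpredN // => p pD xp.
    by rewrite r0.
  by rewrite dotNr r0 ?oppr0.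
rewrite -[RHS]ur dotBr dot_sumr dotBl dot_suml; congr (_ - _).
by apply: eq_bigr => p _; rewrite dotZl dotZr mulrC.
Qed.

(** Carries minimality from one polytope to another: it is enough that [y] attains at once the
    minima of all normals active at [x]. *)
Lemma normal_cone_min D x u (Q : set V) y : hpoly D x -> nondeg D x ->
  (forall z, hpoly D z -> dot u x <= dot u z) ->
  Q y -> (forall z, Q z -> z - y \in W) ->
  (forall p z, p \in D -> act x p -> Q z -> dot p.1 y <= dot p.1 z) ->
  forall z, Q z -> dot u y <= dot u z.
Proof.
move=> Dx nd umin Qy QW H z Qz.
have [c [l [c0 l0 ->]]] := normal_decomp Dx nd umin.
rewrite -subr_ge0 -dotBr dotDl l0 ?QW // add0r dot_suml big_seq_cond.
apply: sumr_ge0 => p /andP[]; rewrite mem_undup => pD xp.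
by rewrite dotZl mulr_ge0 // dotBr subr_ge0 H.
Qed.

(* If y does not minimize u, some edge at y decreases u: y' is its other end. *)
Lemma simplex_step D y u : hvertex D y -> nondeg D y ->
  ray_free (hpoly D) -> (forall z, hpoly D z -> dot u y <= dot u z) \/
  exists y', [/\ hvertex D y', joined (hpoly D) y' y & dot u y' < dot u y].
Proof.
move=> [Dy yv] nd ray; have [e He] := dual_vectors nd.
have [[p0 [p0D p0y ue]]|none] := pselect (exists p, [/\ p \in D, act y p &
    dot u (e p) < 0]); last first.
  left=> z Dz; rewrite -subr_ge0 -dotBr.
  have zyW := hpoly_diff Dz Dy; have [rW r0] := dual_residue He zyW.
  have /eqP := yv _ rW r0; rewrite subr_eq0 => /eqP ->.
  rewrite dot_sumr big_seq_cond; apply: sumr_ge0 => p /andP[].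
  rewrite mem_undup => pD yp; rewrite dotZr mulr_ge0 //.
    by rewrite dotBr (eqP yp) subr_ge0 Dz.2.
  by rewrite leNgt; apply/negP => lt0; apply: none; exists p.
right; have [eW e_act] := He p0.
have e0 : e p0 != 0.
  by apply: contraTneq ue => ->; rewrite dot0r ltxx.
have edge v : v \in W ->
    (forall p, p \in D -> act y p -> p != p0 -> dot p.1 v = 0) ->
    v = dot p0.1 v *: e p0.
  move=> vW Hv; apply/eqP; rewrite -subr_eq0; apply/eqP; apply: yv.
    by rewrite rpredB // rpredZ.
  move=> p pD yp; rewrite dotBr dotZr e_act //.
  have [->|pp0] := eqVneq p p0; first by rewrite mulr1 subrr.
  by rewrite Hv // mulr0 subrr.
have [|t [p1 [t0 Dy' p1D p1e p1y']]] := hpoly_exit Dy ray eW e0.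
  by move=> p pD yp; rewrite e_act.
set y' := y + t *: e p0 in Dy' p1y' *.
have y'act p : p \in D -> act y p -> p != p0 -> act y' p.
  by move=> pD yp pp0; rewrite /act dot_lin e_act // (negPf pp0) mulr0 addr0.
exists y'; split; last by rewrite dot_lin; nra.
  split=> // v vW Hv.
  have vE : v = dot p0.1 v *: e p0.
    by apply: edge => // p pD yp pp0; apply: Hv => //; exact: y'act.
  have /eqP := Hv p1 p1D p1y'; rewrite {1}vE dotZr mulf_eq0 (lt_eqF p1e) orbF.
  by move=> /eqP p0v; rewrite vE p0v scale0r.
(* Dropping [p0] from the active constraints of [y] leaves a face whose direction is the line of
   [e p0]. *)
pose A p := act y p && (p != p0).
pose E := [set x | hpoly D x /\ forall p, p \in D -> A p -> act x p].
have Ey : E y by split=> // p pD /andP[].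
have Ey' : E y' by split=> // p pD /andP[]; exact: y'act.
exists E; split=> //; split.
  by apply: (@hface D A y) => // p pD /andP[].
have <- : \dim <[e p0]>%VS = 1%N by rewrite dim_vline e0.
apply: (@adimE _ _ _ _ y).
  move=> x [Dx xE]; apply/vlineP; exists (dot p0.1 (x - y)).
  apply: edge (hpoly_diff Dx Dy) _ => p pD yp pp0.
  by rewrite dotBr (eqP yp) (eqP (xE p pD _)) ?subrr // /A yp.
move=> U' HU'; have := HU' _ _ Ey' Ey; rewrite addrC addKr => teU.
by rewrite -memvE -[e p0](scalerK (lt0r_neq0 t0)) memvZ.
Qed.

(** * The lowest vertices off a face *)

Section Gap.
Context (D : seq (V * R)) (u : V) (h : R).
Local Notation P := (hpoly D).
Local Notation F := [set x | hpoly D x /\ dot u x = h].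
Hypothesis ray : ray_free P.
Hypothesis nd : forall x, P x -> nondeg D x.
Hypothesis h_min : forall x, P x -> h <= dot u x.
Hypothesis F_neq0 : F !=set0.

Lemma gap_support : support P u = h.
Proof.
by have [x [Px xh]] := F_neq0; rewrite (support_argmin Px) ?xh.
Qed.

(** The lowest vertex above level [h] has a descending edge, whose other end is a lower vertex and
    so lies in [F]. Therefore the minimum over the neighbours of [F] in [delta] is a minimum over
    all vertices off [F]. *)
Lemma gap_vertex : (exists2 y, hvertex D y & h < dot u y) ->
  exists y, [/\ hvertex D y, h < dot u y,
    forall y', hvertex D y' -> h < dot u y' -> dot u y <= dot u y' &
    exists x, [/\ vertex P x, F x & joined P x y]].
Proof.
move=> [y1 y1v y1h].
have [||y [yv yh] ymin] := @hvertex_argmin D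
    [set y | hvertex D y /\ h < dot u y] (dot u).
- by move=> y [].
- by exists y1.
exists y; split=> //; first by move=> y' ? ?; apply: ymin.
have [ymin'|[x [xv xy ltx]]] := simplex_step u yv (nd yv.1) ray.
  by have [x [Px xh]] := F_neq0; have := ymin' x Px; rewrite xh leNgt yh.
exists x; split=> //; first exact/hvertexP.
split; first exact: xv.1.
apply/eqP; rewrite eq_le h_min ?andbT; last exact: xv.1.
by rewrite leNgt; apply/negP => hx; have := ymin x (conj xv hx);
  rewrite leNgt ltx.
Qed.

Lemma delta_le y : hvertex D y -> h < dot u y -> delta P F u <= dot u y - h.
Proof.
move=> yv yh; rewrite /delta gap_support.
have [|y0 [y0v y0h y0min [x [xv Fx xy]]]] := gap_vertex; first by exists y.
apply: (@le_trans _ _ (dot u y0 - h)); last by rewrite lerD2r y0min.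
apply: ge_inf; last first.
  exists y0 => //; split; first exact/hvertexP; last by exists x.
  by case=> _ y0F; rewrite y0F ltxx in y0h.
by exists 0 => _ [z [/hvertexP zv _ _] <-]; rewrite subr_ge0 h_min //; case: zv.
Qed.

Lemma le_delta m : (exists2 x, P x & h < dot u x) ->
  (forall y, hvertex D y -> h < dot u y -> m <= dot u y - h) ->
  m <= delta P F u.
Proof.
move=> [x0 Px0 x0h] mle; rewrite /delta gap_support.
have [x1 [x1v x1u _]] := hpoly_walk (- u) Px0 ray.
have [|y0 [y0v y0h y0min [x [xv Fx xy]]]] := gap_vertex.
  by exists x1 => //; apply: lt_le_trans x0h _; move: x1u; rewrite !dotNl lerN2.
apply: lb_le_inf.
  exists (dot u y0 - h), y0 => //; split; first exact/hvertexP;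
    last by exists x.
  by case=> _ y0F; rewrite y0F ltxx in y0h.
move=> _ [z [/hvertexP - /(_ ray) zv zF _] <-]; apply: mle => //.
rewrite lt_neqAle h_min ?andbT; last exact: zv.1.
by apply/eqP => hz; apply: zF; split=> //; exact: zv.1.
Qed.

(** An infimum over the empty set is 0, so the positivity in [shallow] already forces [F] to meet
    the polytope. *)
Lemma delta_neq0 : delta P F u != 0 -> exists2 x, hvertex D x & F x.
Proof.
have [[x xv Fx] _|none] := pselect (exists2 x, hvertex D x & F x).
  by exists x.
rewrite /delta (_ : [set _ | _ in _] = set0) ?inf0 ?eqxx //.
rewrite -subset0 => t [y [_ _ [x [/hvertexP - /(_ ray) xv Fx _]]] _].
by apply: none; exists x.
Qed.

End Gap.

End HPolyhedra.

(** * Polytopes as intersections of facet half-spaces *)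

Section Weyl.
Context {R : realType} {n : nat}.
Implicit Types (q w x y : 'rV[R]_n) (s ws : seq 'rV[R]_n).

(** The cone generated by [s], with the generators peeled off one at a time as the elimination
    does. *)
Fixpoint gcone s y : Prop :=
  if s is q :: s' then exists2 t, 0 <= t & gcone s' (y - t *: q) else y = 0.

(* Fourier-Motzkin: [t] exists iff each lower bound on it is at most each
   upper bound; [comb w w'] compares the bounds given by [w] and [w']. *)
Lemma gcone_hrep s : exists ws, forall y,
  gcone s y <-> forall w, w \in ws -> 0 <= dot w y.
Proof.
elim: s => [|q s [ws IH]].
  exists ([seq delta_mx 0 i | i <- enum 'I_n] ++
          [seq - delta_mx 0 i | i <- enum 'I_n]) => y /=; split=> [-> w _|H].
    by rewrite dot0r.
  apply/rowP => i; rewrite mxE; apply/eqP; rewrite eq_le -oppr_ge0.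
  rewrite -(dot_delta y) -dotNl !H // mem_cat ?(map_f (fun i =>
    - delta_mx 0 i)) ?map_f ?mem_enum ?orbT //.
pose neg := [seq w <- ws | dot w q < 0].
pose comb w w' := dot w q *: w' - dot w' q *: w.
exists ([seq w <- ws | 0 <= dot w q] ++
        [seq comb w w' | w <- [seq w <- ws | 0 < dot w q], w' <- neg]) => y /=.
split=> [[t t0 /IH H] w|H].
  rewrite mem_cat => /orP[|/allpairsP[[w1 w2] /= []]].
    by rewrite mem_filter => /andP[wq /H]; rewrite dotBr dotZr; nra.
  rewrite !mem_filter => /andP[w1q /H H1] /andP[w2q /H H2] ->.
  rewrite /comb dotBl !dotZl; move: H1 H2; rewrite !dotBr !dotZr.
  set a := dot w1 q in w1q *; set b := dot w2 q in w2q *.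
  set c := dot w1 y; set d := dot w2 y => H1 H2.
  have : 0 <= a * (d - t * b) + (- b) * (c - t * a).
    by rewrite addr_ge0 // mulr_ge0 // ?oppr_ge0 ltW.
  by have -> : a * (d - t * b) + - b * (c - t * a) = a * d - b * c by ring.
have Hpos w : w \in ws -> 0 <= dot w q -> 0 <= dot w y.
  by move=> wws wq; apply: H; rewrite mem_cat mem_filter wq wws.
have Hcomb w w' : w \in ws -> 0 < dot w q -> w' \in neg ->
    0 <= dot w q * dot w' y - dot w' q * dot w y.
  move=> wws wq wneg; rewrite -!dotZl -dotBl; apply: H.
  rewrite mem_cat; apply/orP; right; apply/allpairsP; exists (w, w').
  by rewrite mem_filter wq.
have mem_neg w : w \in ws -> dot w q < 0 -> w \in neg.
  by move=> wws wq; rewrite mem_filter wq.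
have [neg0|neg0] := eqVneq neg [::].
  exists 0 => //; apply/IH => w wws; rewrite scale0r subr0 Hpos // leNgt.
  by apply/negP => /(mem_neg w wws); rewrite neg0.
have [w0 w0neg w0max] := @seq_argmin R _ neg (fun w =>
  - (dot w y / dot w q)) neg0.
set t0 := dot w0 y / dot w0 q.
have := w0neg; rewrite mem_filter => /andP[w0q w0ws].
have t0E : t0 * dot w0 q = dot w0 y by rewrite divfK // lt_eqF.
(* The elements of [neg] give the lower bounds on [t]; the largest of them, or 0, is the least
   candidate. *)
exists (Num.max 0 t0); first by rewrite le_max lexx.
have tmax : 0 <= Num.max 0 t0 by rewrite le_max lexx.
apply/IH => w wws; rewrite dotBr dotZr.
have [wq|wq|wq] := ltgtP (dot w q) 0.
- have : dot w y / dot w q <= t0.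
    by rewrite -lerN2; apply: w0max; exact: mem_neg.
  rewrite ler_ndivrMr // => H1.
  have : t0 <= Num.max 0 t0 by rewrite le_max lexx orbT.
  nra.
- have [_|t0_gt0] := leP t0 0; first by rewrite mul0r subr0 Hpos // ltW.
  have := Hcomb w w0 wws wq w0neg; rewrite -t0E.
  have -> : dot w q * (t0 * dot w0 q) - dot w0 q * dot w y =
    dot w0 q * (t0 * dot w q - dot w y) by ring.
  nra.
- by rewrite wq mulr0 subr0 Hpos // wq.
Qed.

Lemma gcone_map (I : eqType) (f : I -> 'rV[R]_n) (s : seq I) y : uniq s ->
  gcone [seq f i | i <- s] y <->
  exists a : I -> R, (forall i, 0 <= a i) /\ y = \sum_(i <- s) a i *: f i.
Proof.
elim: s y => [|i s IH] y /=.
  move=> _; split=> [->|[a [_]]]; last by rewrite big_nil.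
  by exists (fun=> 0); rewrite big_nil.
case/andP => si us; split=> [[t t0 /IH-/(_ us)[a [a0 yE]]]|[a [a0]]].
  exists (fun j => if j == i then t else a j); split.
    by move=> j; case: ifP.
  rewrite big_cons eqxx -[LHS](subrK (t *: f i)) addrC yE; congr (_ + _).
  rewrite !big_seq; apply: eq_bigr => j js.
  by case: eqP => // ji; rewrite -ji js in si.
rewrite big_cons => ->; exists (a i) => //.
by rewrite addrC addKr; apply/(IH _ us); exists a.
Qed.

End Weyl.

Section Conv.
Context {R : realType} {n : nat}.
Local Notation V := 'rV[R]_n.

Lemma dot_row_mx (w : 'rV[R]_(n + 1)) (x : V) c :
  dot w (row_mx x c%:M) = dot (lsubmx w) x + rsubmx w 0 0 * c.
Proof.
rewrite /dot big_split_ord /=; congr (_ + _).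
  by apply: eq_bigr => i _; rewrite row_mxEl mxE.
by rewrite big_ord1 row_mxEr !mxE eqxx mulr1n.
Qed.

(** Homogenization: [x] is in the hull of the [p i] iff [(x, 1)] is in the cone generated by the
    [(p i, 1)]. The last coordinate of an inequality of the cone becomes its constant term. *)
Lemma conv_hrep k (p : 'I_k -> V) : exists D : seq (V * R), forall x,
  conv p x <-> forall q, q \in D -> q.2 <= dot q.1 x.
Proof.
pose f i := row_mx (p i) 1%:M : 'rV[R]_(n + 1).
have [ws Hws] := gcone_hrep [seq f i | i <- enum 'I_k].
exists [seq (lsubmx w, - rsubmx w 0 0) | w <- ws] => x.
have convE : conv p x <-> gcone [seq f i | i <- enum 'I_k] (row_mx x 1%:M).
  rewrite gcone_map ?enum_uniq //; split=> [[a [a0 a1 ->]]|[a [a0]]].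
    exists a; split=> //; rewrite big_enum /= -[RHS]hsubmxK !linear_sum.
    congr row_mx; first by apply: eq_bigr => i _; rewrite linearZ /= row_mxKl.
    under eq_bigr do rewrite linearZ /= row_mxKr.
    by rewrite -scaler_suml a1 scale1r.
  rewrite big_enum /= => xE; exists a; split=> //.
    have := congr1 (fun y : 'rV_(n + 1) => rsubmx y 0 0) xE.
    rewrite row_mxKr linear_sum summxE mxE eqxx mulr1n => ->.
    by apply: eq_bigr => i _; rewrite linearZ /= row_mxKr !mxE eqxx mulr1.
  have := congr1 (fun y : 'rV_(n + 1) => lsubmx y) xE.
  rewrite row_mxKl linear_sum => ->.
  by apply: eq_bigr => i _; rewrite linearZ /= row_mxKl.
rewrite convE Hws; split=> [H q /mapP[w wws ->] /=|H w wws].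
  by have := H w wws; rewrite dot_row_mx mulr1 -lerBlDr sub0r.
rewrite dot_row_mx mulr1 -lerBlDr sub0r.
exact: (H (_, _) (map_f _ wws)).
Qed.

Lemma conv_vertex k (p : 'I_k -> V) j : conv p (p j).
Proof.
exists (fun i => (i == j)%:R); split=> [i||].
- by rewrite ler0n.
- by rewrite (bigD1 j) //= eqxx big1 ?addr0 // => i /negPf->.
- by rewrite (bigD1 j) //= eqxx scale1r big1 ?addr0 // => i /negPf->;
  rewrite scale0r.
Qed.

Lemma conv_bounded k (p : 'I_k -> V) u :
  exists M, forall x, conv p x -> dot u x <= M.
Proof.
exists (\sum_i `|dot u (p i)|) => _ [a [a0 a1 ->]]; rewrite dot_sumr.
apply: ler_sum => i _; rewrite dotZr.
have ai1 : a i <= 1.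
  by rewrite -a1 (bigD1 i) //= lerDl sumr_ge0.
apply: le_trans (ler_norm _) _; rewrite normrM ger0_norm //.
by rewrite ler_piMl.
Qed.

Lemma bounded_ray_free (P : set V) :
  (forall u, exists M, forall x, P x -> dot u x <= M) -> ray_free P.
Proof.
move=> bd x v Px v0; have [M HM] := bd v; have vv := dotvv_gt0 v0.
have Mx := HM x Px.
exists ((M - dot v x + 1) / dot v v).
  by apply: divr_ge0; [lra | exact: ltW].
by move=> /HM; rewrite dotDr dotZr divfK ?gt_eqF //; lra.
Qed.

Lemma support_le (P : set V) u x b : P x -> (forall y, P y -> b <= dot u y) ->
  support P u <= dot u x.
Proof.
move=> Px bP; apply: ge_inf; last by exists x.
by exists b => _ [y Py <-]; exact: bP.
Qed.

Lemma polytope_bounded (P : set V) : polytope P ->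
  forall u, exists M, forall x, P x -> dot u x <= M.
Proof. by move=> [k [p ->]] u; exact: conv_bounded. Qed.

(** A face is the hull of the generators that it contains, so a set of indices determines it. *)
Lemma finite_faces (P : set V) : polytope P -> finite_set [set F | face P F].
Proof.
move=> [k [p PE]].
pose f (A : {set 'I_k.+1}) : set V := [set x | exists a : 'I_k.+1 -> R,
  [/\ forall i, 0 <= a i, \sum_i a i = 1, forall i, a i != 0 -> i \in A &
      x = \sum_i a i *: p i]].
apply: (@sub_finite_set _ _ [set f A | A in [set: {set 'I_k.+1}]]); last first.
  by apply: finite_image; exact: finite_finset.
move=> F [u FE]; exists [set i | `[< F (p i) >]]%SET => //=.
have [M HM] := conv_bounded p (- u).
have lb x : P x -> support P u <= dot u x.
  move=> Px; apply: (support_le (b := - M)) => // y; rewrite PE => /HM.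
  by rewrite dotNl lerNl.
have Pp i : P (p i) by rewrite PE; exact: conv_vertex.
have dotE (a : 'I_k.+1 -> R) : \sum_i a i = 1 ->
  dot u (\sum_i a i *: p i) - support P u =
    \sum_i a i * (dot u (p i) - support P u).
  move=> a1; rewrite dot_sumr -[X in _ - X]mul1r -a1 big_distrl -sumrB.
  by apply: eq_bigr => i _; rewrite dotZr mulrBr.
rewrite FE; apply/seteqP; split=> x.
  move=> [a [a0 a1 aA ->]]; split; first by rewrite PE; exists a.
  apply/eqP; rewrite -subr_eq0 dotE // big1 // => i _.
  have [->|/aA] := eqVneq (a i) 0; first by rewrite mul0r.
  rewrite inE => /asboolP[_ ->].
  by rewrite subrr mulr0.
move=> [Px xu]; have [a [a0 a1 xE]] : conv p x by rewrite -PE.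
 exists a; split=> // i ai.
rewrite inE; apply/asboolP; split=> //.
have ge0 i' : 0 <= a i' * (dot u (p i') - support P u).
  by rewrite mulr_ge0 // subr_ge0 lb.
move/eqP: xu; rewrite -subr_eq0 xE dotE // => /eqP.
move=> /psumr_eq0P s0.
have /eqP := s0 (fun i' _ => ge0 i') i isT.
by rewrite mulf_eq0 (negPf ai) subr_eq0 => /eqP.
Qed.

End Conv.

(** * Irredundant inequalities and facets *)

Section FacetPresentation.
Context {R : realType} {n : nat}.
Local Notation V := 'rV[R]_n.

Lemma polytope_hpoly (S : set V) : polytope S ->
  exists (W : {vspace V}) o D, [/\ S = hpoly W o D, S o &
    forall U' : {vspace V}, (forall x z, S x -> S z -> x - z \in U') ->
      (W <= U')%VS].
Proof.
move=> [k [p SE]]; have [D HD] := conv_hrep p.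
pose W := <<[seq p j - p ord0 | j <- enum 'I_k.+1]>>%VS.
have Sp j : S (p j) by rewrite SE; exact: conv_vertex.
exists W, (p ord0), D; split=> //.
- rewrite SE; apply/seteqP; split=> x; last by move=> [_ /HD].
  move=> px; split; last exact/HD.
  case: px => a [_ a1 ->]; rewrite -[p ord0]scale1r -a1 scaler_suml -sumrB.
  rewrite rpred_sum // => i _; rewrite -scalerBr rpredZ //.
  by apply/memv_span/(map_f (fun j => p j - p ord0)); rewrite mem_enum.
- move=> U' HU'; apply/span_subvP => _ /mapP[j _ ->]; exact: HU'.
Qed.

Lemma memv_lker_dot (u v : V) : v \in lker (linfun (mulmxr u^T)) ->
  dot u v = 0.
Proof.
rewrite memv_ker lfunE /= => /eqP/matrixP/(_ 0 0).
by rewrite !mxE => <-; apply: eq_bigr => i _; rewrite mxE mulrC.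
Qed.

Lemma lker_dot_memv (u v : V) : dot u v = 0 ->
  v \in lker (linfun (mulmxr u^T)).
Proof.
move=> uv; rewrite memv_ker lfunE /=; apply/eqP/matrixP => i j.
by rewrite !ord1 !mxE -[RHS]uv; apply: eq_bigr => k _; rewrite mxE mulrC.
Qed.

Context (W : {vspace V}) (o : V).

Lemma hpoly_irredundant (D : seq (V * R)) : exists D',
  hpoly W o D' = hpoly W o D /\ forall q, q \in D' -> exists y,
    [/\ y - o \in W, dot q.1 y < q.2 &
        forall p, p \in D' -> p != q -> p.2 <= dot p.1 y].
Proof.
have [m] := ubnP (size D); elim: m D => // m IH D; rewrite ltnS => le_m.
have [[q [qD Hq]]|irr] := pselect (exists q, q \in D /\ forall y, y - o \in W ->
    (forall p, p \in D -> p != q -> p.2 <= dot p.1 y) -> q.2 <= dot q.1 y).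
  have [|D' [D'E D'irr]] := IH [seq p <- D | p != q].
    apply: leq_trans le_m; rewrite size_filter -(count_predC (fun p =>
      p != q) D).
    rewrite -addn1 leq_add2l -has_count; apply/hasP; exists q => //=.
    by rewrite eqxx.
  exists D'; split=> //; rewrite D'E; apply/seteqP; split=> x [xW xD].
    split=> // p pD; have [->|pq] := eqVneq p q; last first.
      by apply: xD; rewrite mem_filter pq.
    by apply: Hq => // r rD rq; apply: xD; rewrite mem_filter rq.
  by split=> // p; rewrite mem_filter => /andP[_ /xD].
exists D; split=> // q qD; apply: contrapT => none; apply: irr; exists q.
split=> // y yW Hy; rewrite leNgt; apply/negP => yq; apply: none.
by exists y.
Qed.

Section Irredundant.
Context (D : seq (V * R)).
Local Notation S := (hpoly W o D).
Hypothesis So : S o.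
Hypothesis Wspan : forall U' : {vspace V},
  (forall x z, S x -> S z -> x - z \in U') -> (W <= U')%VS.

Lemma adim_span : adim S = \dim W.
Proof. by apply: (@adimE _ _ _ _ o) => // x []. Qed.

Hypothesis irr : forall q, q \in D -> exists y,
    [/\ y - o \in W, dot q.1 y < q.2 &
        forall p, p \in D -> p != q -> p.2 <= dot p.1 y].

(** No [q] can be an equality on [S]: it would be one on all of [o + W], contrary to the point that
    violates it. Midpoints then make the inequalities strict one after the other. *)
Lemma interior_point : exists2 x, S x & forall q, q \in D -> q.2 < dot q.1 x.
Proof.
have single q : q \in D -> exists2 x, S x & q.2 < dot q.1 x.
  move=> qD; apply: contrapT => none.
  have Sq x : S x -> dot q.1 x = q.2.
    move=> Sx; apply/eqP; rewrite eq_le Sx.2 // andbT leNgt.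
    by apply/negP => lt; apply: none; exists x.
  have [y [yW yq _]] := irr qD.
  have WU : (W <= lker (linfun (mulmxr q.1^T)))%VS.
    by apply: Wspan => x z Sx Sz; apply: lker_dot_memv;
      rewrite dotBr !Sq ?subrr.
  have := memv_lker_dot (subvP WU _ yW).
  by rewrite dotBr (Sq o) //; lra.
suff : forall l : seq (V * R), {subset l <= D} ->
    exists2 x, S x & forall q, q \in l -> q.2 < dot q.1 x by apply.
elim=> [|q l IH] lD; first by exists o.
have [|x Sx xl] := IH; first by move=> p pl; apply: lD; rewrite inE pl orbT.
have [y Sy yq] := single q (lD q (mem_head _ _)).
exists (x + 2^-1 *: (y - x)).
  by apply: hpoly_convex => //; lra.
move=> p; rewrite inE dot_lin dotBr => /orP[/eqP->|pl].
  have := Sx.2 q (lD q (mem_head _ _)); lra.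
have pD : p \in D by apply: lD; rewrite inE pl orbT.
have := Sy.2 p pD; have := xl p pl; lra.
Qed.

(** The segment from an interior point to a point violating [q] only crosses the hyperplane of [q]
    at a point [z] where [q] alone is active. Near [z] nothing but [q] restricts directions, so the
    face has codimension one. *)
Lemma irredundant_facet q : q \in D -> exists z,
  [/\ S z, act z q, forall p, p \in D -> p != q -> p.2 < dot p.1 z &
    facet S [set x | S x /\ act x q]].
Proof.
move=> qD; have [x0 Sx0 x0D] := interior_point.
have [y [yW yq yD]] := irr qD.
have x0q := x0D q qD.
pose t := (dot q.1 x0 - q.2) / (dot q.1 x0 - dot q.1 y).
have den_gt0 : 0 < dot q.1 x0 - dot q.1 y by lra.
have t_gt0 : 0 < t by rewrite divr_gt0 //; lra.
have t_lt1 : t < 1 by rewrite ltr_pdivrMr // mul1r; lra.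
have tE : t * (dot q.1 x0 - dot q.1 y) = dot q.1 x0 - q.2.
  by rewrite divfK // gt_eqF.
pose z := x0 + t *: (y - x0).
have zq : act z q.
  rewrite /act dot_lin dotBr; apply/eqP.
  have -> : dot q.1 x0 + t * (dot q.1 y - dot q.1 x0) =
    dot q.1 x0 - t * (dot q.1 x0 - dot q.1 y) by ring.
  by rewrite tE; ring.
have zD p : p \in D -> p != q -> p.2 < dot p.1 z.
  move=> pD pq; rewrite dot_lin dotBr.
  have := x0D p pD; have := yD p pD pq; nra.
have zW : z - o \in W.
  have -> : z - o = (x0 - o) + t *: ((y - o) - (x0 - o)).
    by rewrite opprB addrA subrK /z addrAC.
  by case: Sx0 => x0W _; rewrite rpredD // rpredZ // rpredB.
have Sz : S z.
  split=> // p pD; have [->|/(zD p pD)/ltW//] := eqVneq p q.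
  by rewrite (eqP zq).
exists z; split=> //.
split.
  have [] := @hface _ _ W o D (pred1 q) z Sz => [p _ /eqP-> //|u Hu].
  exists u; rewrite -Hu; apply/seteqP; split=> x [Sx Hx]; split=> //.
    by move=> p _ /eqP->.
  exact: Hx qD (eqxx q).
pose f := linfun (mulmxr q.1^T) : 'Hom(V, 'rV[R]_1).
have imf : (f @: W = fullv)%VS.
  apply/eqP; rewrite eqEdim subvf dimvf /dim /= muln1 lt0n dimv_eq0.
  apply/eqP => im0; have x0zW := hpoly_diff Sx0 Sz.
  have : f (x0 - z) \in (f @: W)%VS by apply: memv_img.
  rewrite im0 memv0 => fx; have := memv_lker_dot (u := q.1) (v := x0 - z).
  by rewrite memv_ker => /(_ fx); rewrite dotBr (eqP zq); lra.
rewrite adim_span -(limg_ker_dim f W) imf dimvf /dim /= muln1 addn1; congr _.+1.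
apply: (@adimE _ _ _ _ z) => [x [Sx xq]|U' HU'].
  rewrite memv_cap (hpoly_diff Sx Sz) /=.
  by apply: lker_dot_memv; rewrite dotBr (eqP xq) (eqP zq) subrr.
apply/subvP => v; rewrite memv_cap => /andP[vW /memv_lker_dot vq].
have [|e e_gt0 He] := hpoly_step Sz vW.
  move=> p pD zp; have [->|/(zD p pD)] := eqVneq p q; first by rewrite vq.
  by rewrite (eqP zp) ltxx.
have Sez : S (z + e *: v) by apply: He; rewrite lexx ltW.
have evU : z + e *: v - z \in U'.
  by apply: HU'; split=> //; rewrite /act dot_lin vq mulr0 addr0.
rewrite [z + _]addrC addrK in evU.
by rewrite -[v](scalerK (lt0r_neq0 e_gt0)) memvZ.
Qed.

(* [nu G] is a positive multiple of the irredundant normal [q.1] on [W]: both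
   vanish on the direction of the facet cut out by [q]. *)
Lemma facets_cut (nu : set V -> V) :
  (forall G, facet S G -> G = [set x |
    S x /\ dot (nu G) x = support S (nu G)]) ->
  (forall G x, facet S G -> S x -> support S (nu G) <= dot (nu G) x) ->
  forall x, x - o \in W ->
  (forall G, facet S G -> support S (nu G) <= dot (nu G) x) -> S x.
Proof.
move=> nuE nu_le x xW xG; split=> // q qD.
have [x0 Sx0 x0D] := interior_point.
have [z [Sz zq zD Gfacet]] := irredundant_facet qD.
set G := [set x | S x /\ act x q] in Gfacet.
have Gz : G z by split.
have nuz : dot (nu G) z = support S (nu G).
  by move: Gz; rewrite {1}(nuE G Gfacet) => -[].
have nu0 : dot (nu G) z < dot (nu G) x0.
  rewrite nuz lt_neqAle nu_le // andbT; apply/eqP => eq0.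
  have : G x0 by rewrite (nuE G Gfacet).
  by case=> _ /eqP x0q; have := x0D q qD; rewrite x0q ltxx.
have ker v : v \in W -> dot q.1 v = 0 -> dot (nu G) v = 0.
  move=> vW vq.
  have pos w : w \in W -> dot q.1 w = 0 -> 0 <= dot (nu G) w.
    move=> wW wq; have [|e e_gt0 He] := hpoly_step Sz wW.
      move=> p pD zp; have [->|/(zD p pD)] := eqVneq p q; first by rewrite wq.
      by rewrite (eqP zp) ltxx.
    have := nu_le G _ Gfacet (He e _); rewrite lexx ltW // => /(_ isT).
    by rewrite -nuz dot_lin; nra.
  apply/eqP; rewrite eq_le pos // andbT -oppr_ge0 -dotNr pos ?rpredN //.
  by rewrite dotNr vq oppr0.
(* For this [a], the vector [x - z - a (x0 - z)] is killed by [q.1], hence by [nu G]: both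
   functionals see [x] and [x0] in the same ratio. *)
pose a := dot q.1 (x - z) / dot q.1 (x0 - z).
have x0q := x0D q qD.
have den_gt0 : 0 < dot q.1 (x0 - z) by rewrite dotBr (eqP zq); lra.
have xzW : x - z \in W.
  have -> : x - z = (x - o) - (z - o) by rewrite opprB addrA subrK.
  by case: Sz => zW _; rewrite rpredB.
have := ker (x - z - a *: (x0 - z)).
rewrite rpredB ?rpredZ ?(hpoly_diff Sx0 Sz) // !(dotBr _ (x - z)) !dotZr.
rewrite divfK ?gt_eqF // subrr => /(_ isT erefl) /eqP;
  rewrite subr_eq0 => /eqP nux.
have := xG G Gfacet; rewrite -nuz -subr_ge0 -dotBr nux.
rewrite pmulr_lge0; last by rewrite dotBr subr_gt0.
by rewrite pmulr_lge0 ?invr_gt0 // dotBr (eqP zq) subr_ge0.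
Qed.

End Irredundant.

(* The active normals, dim W in number, separate the points of W. *)
Lemma nondeg_vertex (s : seq (V * R)) x : uniq s ->
  size [seq p <- s | act x p] = \dim W -> hvertex W o s x -> nondeg W s x.
Proof.
move=> us sz [_ xv] t; set sx := [seq p <- s | act x p] in sz.
pose M : 'M[R]_(n, size sx) := \matrix_(i, j) (tnth (in_tuple sx) j).1 0 i.
pose f := linfun (mulmxr M) : 'Hom(V, 'rV[R]_(size sx)).
have fE v j : f v 0 j = dot (tnth (in_tuple sx) j).1 v.
  by rewrite lfunE /= mxE; apply: eq_bigr => i _; rewrite !mxE mulrC.
have ker0 : (W :&: lker f = 0)%VS.
  apply/eqP; rewrite -subv0; apply/subvP => v.
  rewrite memv_cap memv_ker memv0 => /andP[vW /eqP fv].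
  apply/eqP/xv => // p ps xp; have psx : p \in sx by rewrite mem_filter xp.
  have /tnthP[j pE] : p \in in_tuple sx by [].
  by rewrite pE -fE fv mxE.
have imf : (f @: W = fullv)%VS.
  have dimf : \dim (f @: W) = size sx.
    by rewrite [RHS]sz -[RHS](limg_ker_dim f W) ker0 dimv0.
  by apply/eqP; rewrite eqEdim subvf dimvf /dim /= mul1n dimf.
have : \row_j t (tnth (in_tuple sx) j) \in (f @: W)%VS by rewrite imf memvf.
case/memv_imgP => v vW fv; exists v => // p ps xp.
have /tnthP[j pE] : p \in in_tuple sx by rewrite /= mem_filter xp.
by rewrite pE -fE -fv mxE.
Qed.

End FacetPresentation.

Section SimplePresentation.
Context {R : realType} {n : nat} (S : set 'rV[R]_n) (nu : set 'rV[R]_n ->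
  'rV[R]_n).
Local Notation V := 'rV[R]_n.

Lemma size_card (T : choiceType) (s : seq T) m : uniq s ->
  ([set` s] #= `I_m)%card -> size s = m.
Proof.
move=> us /card_fset_set <-; apply: perm_size; apply: uniq_perm => // x.
rewrite in_fset_set; last by apply/finite_seqP; exists s.
by apply/idP/idP; rewrite inE.
Qed.

(** Simplicity enters here: a vertex lies on exactly [\dim W] facets, so their normals are
    independent on [W]. For any other point, walking to a vertex (in the direction 0, only the
    active constraints matter) embeds its active constraints in those of the vertex. *)
Lemma simple_presentation : simple_polytope S -> facet_normals S nu ->
  exists (W : {vspace V}) o (fs : seq (set V)),
  let D := [seq (nu G, support S (nu G)) | G <- fs] in
  [/\ uniq fs, [set` fs] = [set G | facet S G], S = hpoly W o D, S o &
      forall x, S x -> nondeg W D x].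
Proof.
move=> [polyS simpleS] normals.
have bd := polytope_bounded polyS; have ray := bounded_ray_free bd.
have [fs0 fs0E] : exists s : seq (set V), [set G | facet S G] = [set` s].
  apply/finite_seqP; apply: sub_finite_set (finite_faces polyS).
  by move=> G [].
pose fs := undup fs0; have ufs : uniq fs by exact: undup_uniq.
have fsE : [set` fs] = [set G | facet S G].
  by rewrite fs0E; apply/seteqP; split=> G /=; rewrite mem_undup.
have fsP G : G \in fs <-> facet S G.
  by have := congr1 (fun A => A G) fsE => /= ->.
have nuE G : facet S G -> G = [set x | S x /\ dot (nu G) x = support S (nu G)].
  by move=> /normals[].
have nu_le G x : facet S G -> S x -> support S (nu G) <= dot (nu G) x.
  move=> _ Sx; have [M HM] := bd (- nu G).
  apply: (support_le (b := - M)) => // y /HM.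
  by rewrite dotNl lerNl.
have [W [o [D0 [SE0 So Wspan]]]] := polytope_hpoly polyS.
have [D1 [D1E irr]] := hpoly_irredundant W o D0.
have SE1 : S = hpoly W o D1 by rewrite D1E.
pose D := [seq (nu G, support S (nu G)) | G <- fs].
have SE : S = hpoly W o D.
  apply/seteqP; split=> x.
    move=> Sx; split; first by move: Sx; rewrite SE1 => -[].
    by move=> _ /mapP[G /fsP fG ->]; exact: nu_le.
  move=> [xW xD]; rewrite SE1; apply: (@facets_cut _ _ W o D1 _ _ _ nu) => //.
  - by rewrite -SE1.
  - by rewrite -SE1.
  - by rewrite -SE1.
  - by rewrite -SE1.
  - rewrite -SE1 => G /fsP fG; apply: (xD (nu G, support S (nu G))).
    exact: (map_f (fun G => (nu G, support S (nu G)))).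
exists W, o, fs; split=> // x Sx.
have inj : {in fs &, injective (fun G => (nu G, support S (nu G)))}.
  by move=> G G' /fsP fG /fsP fG' [nuGG' _];
    rewrite (nuE G) // (nuE G') // nuGG'.
have uD : uniq D by rewrite map_inj_in_uniq.
have [y [yv _ xy]] : exists y, [/\ hvertex W o D y, dot 0 y <= dot 0 x &
    forall p, p \in D -> act x p -> act y p].
  by apply: hpoly_walk; rewrite -SE.
suff ndy : nondeg W D y.
  move=> t; have [v vW Hv] := ndy t; exists v => // p pD xp.
  by apply: Hv => //; exact: xy.
apply: (nondeg_vertex uD _ yv).
have [Sy yver] : S y /\ vertex S y.
  by split; rewrite SE; [case: yv | apply/hvertexP => //; rewrite -SE].
have := simpleS y yver.
have -> : adim S = \dim W by rewrite SE1; apply: adim_span; rewrite -SE1.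
have -> : [set G | facet S G /\ G y] = [set` [seq G <- fs | act y (nu G,
  support S (nu G))]].
  apply/seteqP; split=> G /=; rewrite mem_filter.
    move=> [fG]; rewrite {1}(nuE G fG) => -[_ /eqP yG].
    by rewrite /act /= yG /=; exact/fsP.
  move=> /andP[yG /fsP fG]; split=> //; rewrite (nuE G fG); split=> //.
  exact/eqP.
move/size_card => <-; last exact: filter_uniq.
by rewrite filter_map size_map.
Qed.

End SimplePresentation.

(** * Truncations of simple polytopes *)

Section Listings.
Context {R : realType} {n : nat}.
Implicit Types (B : set (set 'rV[R]_n)) (s : seq (set 'rV[R]_n)).

Lemma listing_after B s s1 U s2 J : inclusion_listing B s ->
  s = s1 ++ U :: s2 -> J \in s2 -> ~ J `<=` U.
Proof.
move=> [us _ ord] sE Js2 JU.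
have neJU : J <> U.
  move=> JE; move: us; rewrite sE cat_uniq /= -JE Js2 /=.
  by rewrite !andbF.
pose i := (size s1 + (index J s2).+1)%N.
have Jlt : (index J s2 < size s2)%N by rewrite index_mem.
have ni : nth set0 s i = J.
  by rewrite sE nth_cat /i ltnNge leq_addr /= addKn /= nth_index.
have nj : nth set0 s (size s1) = U by rewrite sE nth_cat ltnn subnn.
have szi : (i < size s)%N by rewrite sE size_cat /= ltn_add2l ltnS.
have szj : (size s1 < size s)%N by rewrite sE size_cat /= addnS ltnS leq_addr.
have : (i < size s1)%N.
  by apply: (ord _ _ szi szj); rewrite ni nj properEneq; split=> //; apply/eqP.
by rewrite ltnNge leq_addr.
Qed.

(** Back substitution from the end of the list: [q F] is [eps F] minus the [q I] of the later [I]
    containing [F]. As [q I <= eps I], the subtracted sum is at most that of all later depths, which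
    leaves [q F] positive. *)
Lemma triangular s (eps : set 'rV[R]_n -> R) :
  (forall s1 F s2 J, s = s1 ++ F :: s2 -> J \in s2 -> ~ J `<=` F) ->
  (forall F, F \in s -> 0 < eps F) ->
  (forall s1 F s2, s = s1 ++ F :: s2 -> \sum_(G <- s2) eps G < eps F) ->
  exists q : set 'rV[R]_n -> R, (forall F, F \in s -> 0 < q F <= eps F) /\
    forall J, J \in s -> eps J = \sum_(I <- s | `[< J `<=` I >]) q I.
Proof.
elim: s => [|F s IH] ord eps_gt0 sum_lt; first by exists (fun=> 0).
have [|||q [q_bd qE]] := IH.
- by move=> s1 G s2 J sE; apply: (ord (F :: s1) G s2 J); rewrite sE.
- by move=> G Gs; apply: eps_gt0; rewrite inE Gs orbT.
- by move=> s1 G s2 sE; apply: (sum_lt (F :: s1) G s2); rewrite sE.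
have ordF J : J \in s -> ~ J `<=` F by exact: (ord [::] F s J erefl).
have neF J : J \in s -> (J == F) = false.
  by move=> Js; apply/eqP => JF; apply: (ordF J Js); rewrite JF.
pose qF := eps F - \sum_(I <- s | `[< F `<=` I >]) q I.
pose q' J := if J == F then qF else q J.
have q'E (P : pred (set 'rV[R]_n)) :
    \sum_(I <- s | P I) q' I = \sum_(I <- s | P I) q I.
  rewrite !(big_seq_cond P); apply: eq_bigr => I /andP[/neF IF _].
  by rewrite /q' IF.
exists q'; split.
  move=> J; rewrite inE => /orP[/eqP->|Js]; last by rewrite /q' neF // q_bd.
  rewrite /q' eqxx /qF gerBl subr_gt0; apply/andP; split; last first.
    by rewrite big_seq_cond; apply: sumr_ge0 => I /andP[/q_bd/andP[/ltW]].
  apply: le_lt_trans (sum_lt [::] F s erefl).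
  rewrite big_seq_cond [leRHS]big_seq [leRHS](bigID (fun I =>
    `[< F `<=` I >])) /=.
  rewrite -[leLHS]addr0; apply: lerD.
    by apply: ler_sum => I /andP[/q_bd/andP[]].
  by apply: sumr_ge0 => I /andP[Is _]; rewrite ltW // eps_gt0 // inE Is orbT.
move=> J; rewrite inE => /orP[/eqP->|Js]; rewrite big_cons.
  by case: asboolP => [_|[]//]; rewrite q'E /q' eqxx subrK.
case: asboolP => [JF|_]; first by case: (ordF J Js).
by rewrite q'E qE.
Qed.

End Listings.

Section Truncations.
Context {R : realType} {n : nat}.
Local Notation V := 'rV[R]_n.
Context (S : set V) (nu : set V -> V) (W : {vspace V}) (o : V).
Context (fs : seq (set V)).
Implicit Types (F G I J U : set V) (x y z v : V) (s : seq (set V)).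
Implicit Types (eps : set V -> R).

Definition atom G : V * R := (nu G, support S (nu G)).
Local Notation D0 := [seq atom G | G <- fs].
Local Notation u_ F := (face_normal S nu F).

Hypothesis ufs : uniq fs.
Hypothesis fsP : forall G, G \in fs <-> facet S G.
Hypothesis SE : S = hpoly W o D0.
Hypothesis So : S o.
Hypothesis nd0 : forall x, S x -> nondeg W D0 x.
Hypothesis ray0 : ray_free S.
Hypothesis bdS : forall u, exists M, forall x, S x -> dot u x <= M.
Hypothesis nuE : forall G, facet S G ->
  G = [set x | S x /\ dot (nu G) x = support S (nu G)].

Definition slack G x : R := dot (nu G) x - support S (nu G).
Definition facets_of F := [seq G <- fs | `[< F `<=` G >]].
(** As a sum over facets it makes [fslack F] a sum of slacks by linearity; for [F] in [B] it is the
    support of [S] in the direction [u_ F] ([support_S]). *)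
Definition height F : R := \sum_(G <- facets_of F) support S (nu G).
Definition fslack F x : R := dot (u_ F) x - height F.

Lemma facets_ofP F G : G \in facets_of F <-> G \in fs /\ F `<=` G.
Proof.
rewrite mem_filter; split=> [/andP[/asboolP]|[? ?]] //.
by apply/andP; split=> //; apply/asboolP.
Qed.

Lemma facets_of_uniq F : uniq (facets_of F).
Proof. exact: filter_uniq. Qed.

Lemma face_normalE F : u_ F = \sum_(G <- facets_of F) nu G.
Proof.
rewrite /face_normal [RHS]fsbig_seq; last exact: facets_of_uniq.
congr (\big[_/_]_(G \in _) nu G); apply/seteqP; split=> G /=.
  by move=> [fG FG]; apply/facets_ofP; rewrite fsP.
by move=> /facets_ofP[/fsP].
Qed.

Lemma fslackE F x : fslack F x = \sum_(G <- facets_of F) slack G x.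
Proof. by rewrite /fslack face_normalE dot_suml /height -sumrB. Qed.

Lemma fslack_lin F x t v : fslack F (x + t *: v) =
  fslack F x + t * dot (u_ F) v.
Proof. by rewrite /fslack dot_lin; ring. Qed.

Lemma slack_lin G x t v : slack G (x + t *: v) = slack G x + t * dot (nu G) v.
Proof. by rewrite /slack dot_lin; ring. Qed.

Lemma act_atom G x : act x (atom G) = (slack G x == 0).
Proof. by rewrite /act /slack subr_eq0. Qed.

Lemma mem_atom G : G \in fs -> atom G \in D0.
Proof. exact: map_f. Qed.

Lemma atom_inj G G' : G \in fs -> G' \in fs -> atom G = atom G' -> G = G'.
Proof.
move=> /fsP fG /fsP fG' [nuGG' _].
by rewrite (nuE fG) (nuE fG') nuGG'.
Qed.

Lemma SP x : S x = hpoly W o D0 x.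
Proof. exact: (congr1 (fun A => A x) SE). Qed.

Lemma slack_ge0 G x : G \in fs -> S x -> 0 <= slack G x.
Proof.
by move=> fG; rewrite SP => -[_ /(_ _ (mem_atom fG))]; rewrite /slack subr_ge0.
Qed.

Lemma facet_slack G x : G \in fs -> G x <-> S x /\ slack G x = 0.
Proof.
move=> /fsP fG; have GE := congr1 (fun A => A x) (nuE fG); rewrite /= in GE.
rewrite GE /slack; split=> -[Sx]; first by move=> ->; rewrite subrr.
by move=> /eqP; rewrite subr_eq0 => /eqP.
Qed.

Lemma fslack_ge0 F x : S x -> 0 <= fslack F x.
Proof.
move=> Sx; rewrite fslackE big_seq; apply: sumr_ge0 => G /facets_ofP[fG _].
exact: slack_ge0.
Qed.

Lemma fslack_eq0 F x : S x ->
  fslack F x = 0 <-> (forall G, G \in fs -> F `<=` G -> slack G x = 0).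
Proof.
move=> Sx; rewrite fslackE; split=> [s0 G fG FG|H]; last first.
  by rewrite big1_seq // => G /= /facets_ofP[]; exact: H.
have /eqP := s0; rewrite big_seq psumr_eq0; last first.
  by move=> G' /facets_ofP[fG' _]; exact: slack_ge0.
have GF : G \in facets_of F by apply/facets_ofP.
by move=> /allP/(_ G GF)/implyP/(_ GF)/eqP.
Qed.

(** Expand the direction exposing [F] in the facet normals tight at a minimizer, with nonnegative
    coefficients. A facet with nonzero coefficient is tight on all of [F], hence contains it;
    conversely, where these slacks vanish the direction attains its minimum. *)
Lemma face_slackP F x : proper_face S F ->
  F x <-> S x /\ forall G, G \in fs -> F `<=` G -> slack G x = 0.
Proof.
move=> [[u FE] neFS].
have [z zv zmin] : exists2 z, hvertex W o D0 z &
    forall y, hpoly W o D0 y -> dot u z <= dot u y.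
  by apply: (@hpoly_min _ _ _ _ _ o) => //; rewrite -SE.
have Sz : S z by rewrite SP; case: zv.
rewrite -SE in zmin; have suppE := support_argmin Sz zmin.
split=> [Fx|[Sx Hx]].
  have Sx : S x by move: Fx; rewrite FE => -[].
  by split=> // G fG /(_ _ Fx) /(facet_slack x fG)[].
have [|c [l [c0 l0 uE]]] := @normal_decomp _ _ W o D0 z u zv.1 (nd0 Sz).
  by rewrite -SE.
have diffE y : S y -> dot u y - dot u z =
    \sum_(p <- undup D0 | (p \in undup D0) && act z p) c p * (dot p.1 y - p.2).
  move=> Sy; have yzW : y - z \in W by rewrite SP in Sz; rewrite SP in Sy;
    exact: hpoly_diff Sy Sz.
  rewrite -dotBr uE dotDl l0 // add0r dot_suml big_seq_cond.
  by apply: eq_bigr => p /andP[_ /eqP zp]; rewrite dotZl dotBr zp.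
rewrite FE; split=> //; rewrite suppE; apply/eqP; rewrite -subr_eq0 diffE //.
apply/eqP; rewrite big1 // => p /andP[]; rewrite mem_undup => pD zp.
have [->|cp] := eqVneq (c p) 0; first by rewrite mul0r.
have /mapP[G fG pE] := pD; rewrite pE /= -/(slack G x) Hx ?mulr0 // => y Fy.
move: Fy; rewrite FE => -[Sy /eqP]; rewrite suppE -subr_eq0 diffE //.
rewrite psumr_eq0; last first.
  move=> q /andP[]; rewrite mem_undup; rewrite SP in Sy.
  by move=> /Sy.2 qy _; rewrite mulr_ge0 ?c0 // subr_ge0.
move=> /allP/(_ p); rewrite mem_undup pD zp => /(_ isT) /=.
rewrite mulf_eq0 (negPf cp) /= pE => /eqP yG.
exact/(facet_slack y fG).
Qed.

Lemma face_sub F x : proper_face S F -> F x -> S x.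
Proof. by move=> pF /(face_slackP x pF)[]. Qed.

Lemma fslack0P F x : proper_face S F -> S x -> fslack F x = 0 <-> F x.
Proof.
by move=> pF Sx; rewrite face_slackP // fslack_eq0 //; split=> [|[]].
Qed.

Lemma fslack_gt0 F x : proper_face S F -> S x -> ~ F x -> 0 < fslack F x.
Proof.
move=> pF Sx Fx; rewrite lt_neqAle fslack_ge0 // andbT eq_sym.
by apply/eqP => /(fslack0P pF Sx).
Qed.

Lemma face_neq0 F : proper_face S F -> exists x, F x.
Proof.
move=> [[u FE] _]; have [z zv zmin] : exists2 z, hvertex W o D0 z &
    forall y, hpoly W o D0 y -> dot u z <= dot u y.
  by apply: (@hpoly_min _ _ _ _ _ o) => //; rewrite -SE.
have Sz : S z by rewrite SP; case: zv.
rewrite -SE in zmin; exists z; rewrite FE; split=> //.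
by rewrite (support_argmin Sz zmin).
Qed.

Lemma faceE F : proper_face S F ->
  F = [set x | hpoly W o D0 x /\ dot (u_ F) x = height F].
Proof.
move=> pF; rewrite -SE; apply/seteqP; split=> x.
  move=> Fx; have Sx := face_sub pF Fx; split=> //.
  by move/(fslack0P pF Sx): Fx => /eqP; rewrite subr_eq0 => /eqP.
by move=> [Sx ux]; apply/(fslack0P pF Sx); rewrite /fslack ux subrr.
Qed.

(** * Truncations as systems of inequalities *)

Definition cut eps F : V * R := (u_ F, eps F + height F).
Definition constraints eps s := D0 ++ [seq cut eps F | F <- s].
Local Notation Q eps s := (hpoly W o (constraints eps s)).

Lemma act_cut eps F x : act x (cut eps F) = (fslack F x == eps F).
Proof. by rewrite /act /fslack subr_eq. Qed.

Lemma mem_constraints_rcons eps s F p :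
  (p \in constraints eps (rcons s F)) =
  (p == cut eps F) || (p \in constraints eps s).
Proof. by rewrite !mem_cat map_rcons mem_rcons inE orbCA. Qed.

Lemma QP eps s x :
  Q eps s x <-> S x /\ forall F, F \in s -> eps F <= fslack F x.
Proof.
rewrite SP; split=> [[xW xD]|[[xW xD] xs]].
  split; first by split=> // p pD; apply: xD; rewrite mem_cat pD.
  move=> F Fs; rewrite lerBrDr; apply: (xD (cut eps F)).
  by rewrite mem_cat map_f // orbT.
split=> // p; rewrite mem_cat => /orP[/xD//|/mapP[F Fs ->]].
by rewrite /= -lerBrDr xs.
Qed.

Lemma Q_ray eps s : ray_free (Q eps s).
Proof.
move=> x v /QP[Sx _] v0; have [t t0 nS] := ray0 Sx v0.
by exists t => // /QP[].
Qed.

Lemma Q_nil eps : Q eps [::] = S.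
Proof. by rewrite /constraints cats0 -SE. Qed.

Lemma Q_rcons eps s F x :
  Q eps (rcons s F) x <-> Q eps s x /\ eps F <= fslack F x.
Proof.
rewrite !QP; split=> [[Sx H]|[[Sx H] HF]].
  by do !split=> //; [move=> G Gs|]; apply: H;
    rewrite mem_rcons inE ?Gs ?eqxx ?orbT.
by split=> // G; rewrite mem_rcons inE => /orP[/eqP->|/H].
Qed.

(* The vertex form of [all_shallow]: see [all_shallowP]. *)
Definition gapped eps s := forall s1 F s2, s = s1 ++ F :: s2 ->
  [/\ proper_face S F, exists2 x, Q eps s1 x & F x, 0 < eps F &
      forall y, hvertex W o (constraints eps s1) y -> 0 < fslack F y ->
        eps F < fslack F y].

Lemma gapped_cat eps s1 s2 : gapped eps (s1 ++ s2) -> gapped eps s1.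
Proof.
by move=> g t1 F t2 sE; apply: (g t1 F (t2 ++ s2)); rewrite sE -catA.
Qed.

Lemma gapped_rcons eps s F : gapped eps (rcons s F) <->
  gapped eps s /\ [/\ proper_face S F, exists2 x, Q eps s x & F x, 0 < eps F &
      forall y, hvertex W o (constraints eps s) y -> 0 < fslack F y ->
        eps F < fslack F y].
Proof.
split=> [g|[g gF] s1 G s2].
  split; first by apply: (@gapped_cat _ _ [:: F]); rewrite cats1.
  by apply: (g s F [::]); rewrite cats1.
case: (lastP s2) => [|s2' H].
  by rewrite cats1 => /rcons_inj[<- <-].
by rewrite -rcons_cons -rcons_cat => /rcons_inj[sE _]; exact: g sE.
Qed.

(** Walk down along [u_ F] to a vertex: it is at depth at most [eps F], and the gap leaves only
    depth 0. *)
Lemma expand1 eps s F x : gapped eps (rcons s F) -> Q eps s x ->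
  fslack F x <= eps F -> exists z, [/\ Q eps s z, F z &
    forall p, p \in constraints eps s -> act x p -> act z p].
Proof.
move=> /gapped_rcons[_ [pF _ _ gap]] Qx xF.
have [z [zv zx xz]] := hpoly_walk (u_ F) Qx (@Q_ray eps s).
have Qz : Q eps s z by case: zv.
have Sz : S z by case/QP: Qz.
exists z; split=> //; apply/(fslack0P pF Sz)/eqP;
  rewrite eq_le fslack_ge0 // andbT.
rewrite leNgt; apply/negP => /(gap z zv); rewrite ltNge => /negP; apply.
by apply: le_trans xF; rewrite lerD2r.
Qed.

(* At a point with the new constraint tight, push to a point of the face F,
   where the old constraints of that point and the facets of F are jointly
   independent; one of these facets was not tight and absorbs the new slope. *)
Lemma nondeg_Q eps s : gapped eps s ->
  forall x, Q eps s x -> nondeg W (constraints eps s) x.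
Proof.
elim/last_ind: s => [_ x|s F IH g x].
  rewrite Q_nil => Sx; rewrite /constraints cats0; exact: nd0.
have /gapped_rcons[gs [pF _ eF gap]] := g.
move=> /Q_rcons[Qx xF]; have [xF'|xF'] := eqVneq (fslack F x) (eps F);
  last first.
  move=> t; have [v vW Hv] := IH gs x Qx t; exists v => // p.
  rewrite mem_constraints_rcons => /orP[/eqP->|]; last exact: Hv.
  by rewrite act_cut (negPf xF').
have Sx : S x by case/QP: Qx.
have [z [Qz Fz xz]] : exists z, [/\ Q eps s z, F z &
    forall p, p \in constraints eps s -> act x p -> act z p].
  by apply: expand1 => //; rewrite xF'.
have [G [fG FG xG]] : exists G, [/\ G \in fs, F `<=` G & slack G x != 0].
  apply: contrapT => none; have : fslack F x = 0.
    apply/fslack_eq0 => // G fG FG; apply/eqP/negPn/negP => xG.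
    by apply: none; exists G.
  by rewrite xF' => eF0; rewrite eF0 ltxx in eF.
move=> t.
(* Constraints tight at [z] but not at [x] are free: they get the value 0, except [atom G], whose
   value is adjusted so that the sum over the facets of [F] is [t (cut eps F)]. *)
pose t1 p := if act x p then t p else 0.
pose t' p := if p == atom G then t (cut eps F) - \sum_(G' <- facets_of F |
  G' != G) t1 (atom G')
  else t1 p.
have [v vW Hv] := IH gs z Qz t'.
have GF : G \in facets_of F by apply/facets_ofP.
have uF : dot (u_ F) v = t (cut eps F).
  rewrite face_normalE dot_suml big_seq.
  have -> : \sum_(G' <- facets_of F | G' \in facets_of F) dot (nu G') v =
      \sum_(G' <- facets_of F | G' \in facets_of F) t' (atom G').
    apply: eq_bigr => G' /facets_ofP[fG' FG'].
    have := Hv (atom G'); apply; first by rewrite mem_cat mem_atom.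
    by rewrite act_atom; apply/eqP;
      have [_] := (facet_slack z fG').1 (FG' z Fz).
  rewrite -big_seq (bigD1_seq G) ?facets_of_uniq //= {1}/t' eqxx.
  rewrite addrC; apply/eqP; rewrite addrA subr_eq; apply/eqP.
  rewrite addrC; congr (_ + _); rewrite big_seq_cond [RHS]big_seq_cond.
  apply: eq_bigr => G' /andP[/facets_ofP[fG' _] G'G].
  rewrite /t'; case: eqP => // /(atom_inj fG' fG) G'E.
  by rewrite G'E eqxx in G'G.
exists v => // p; rewrite mem_constraints_rcons => /orP[/eqP-> //|pD xp].
rewrite (Hv p pD (xz p pD xp)) /t' /t1 xp; case: eqP => // pE.
by move: xp; rewrite pE act_atom (negPf xG).
Qed.

Lemma release eps s G x : gapped eps s -> Q eps s x -> G \in fs ->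
  exists x1, [/\ Q eps s x1, 0 < slack G x1 & forall p,
    p \in constraints eps s -> p != atom G -> act x p -> act x1 p].
Proof.
move=> g Qx fG; have Sx : S x by case/QP: Qx.
have [xG|xG] := eqVneq (slack G x) 0; last first.
  by exists x; split=> //; rewrite lt_neqAle slack_ge0 // eq_sym xG.
have [v vW Hv] := nondeg_Q g Qx (fun p => (p == atom G)%:R).
have [|e e_gt0 He] := hpoly_step Qx vW.
  by move=> p pD xp; rewrite Hv // ler0n.
exists (x + e *: v); split; first by apply: He; rewrite lexx ltW.
  rewrite slack_lin xG add0r; have := Hv (atom G).
  by rewrite mem_cat mem_atom // act_atom xG eqxx => -> //; rewrite eqxx mulr1.
move=> p pD pG xp; have := Hv p pD xp; rewrite (negPf pG) => pv.
by rewrite /act dot_lin pv mulr0 addr0.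
Qed.

Lemma proper_face_facet F : proper_face S F -> exists2 G, G \in fs & F `<=` G.
Proof.
move=> pF; apply: contrapT => none; case: (pF) => _; apply.
apply/seteqP; split=> [x|x Sx]; first exact: face_sub.
by apply/(face_slackP x pF); split=> // G fG FG; case: none; exists G.
Qed.

Lemma shallowP eps s F : gapped eps s -> proper_face S F ->
  shallow (eps F) (Q eps s) (F `&` Q eps s) (u_ F) <->
  [/\ exists2 x, Q eps s x & F x, 0 < eps F &
      forall y, hvertex W o (constraints eps s) y -> 0 < fslack F y ->
        eps F < fslack F y].
Proof.
move=> g pF; rewrite /shallow.
have QS x : Q eps s x -> S x by case/QP.
have -> : F `&` Q eps s = [set x | Q eps s x /\ dot (u_ F) x = height F].
  apply/seteqP; split=> x [].
    move=> Fx Qx; split=> //; apply/eqP; rewrite -subr_eq0; apply/eqP.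
    exact/(fslack0P pF (QS x Qx)).
  move=> Qx ux; split=> //; apply/(fslack0P pF (QS x Qx)).
  by rewrite /fslack ux subrr.
have h_min x : Q eps s x -> height F <= dot (u_ F) x.
  by move=> /QS/(fslack_ge0 F); rewrite subr_ge0.
have ray := @Q_ray eps s; have nd := nondeg_Q g.
have memF x : Q eps s x -> F x -> dot (u_ F) x = height F.
  by move=> Qx /(fslack0P pF (QS x Qx))/eqP; rewrite subr_eq0 => /eqP.
split=> [/andP[e_gt0 e_lt]|[[x Qx Fx] e_gt0 gap]].
  have [|x xv [Qx ux]] := delta_neq0 ray (u := u_ F) (h := height F).
    by rewrite gt_eqF // (lt_trans e_gt0).
  split=> //.
    by exists x => //; apply/(fslack0P pF (QS x Qx)); rewrite /fslack ux subrr.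
  move=> y yv y_gt0; apply: lt_le_trans e_lt _.
  have F_neq0 : [set x | Q eps s x /\ dot (u_ F) x = height F] !=set0.
    by exists x; split.
  by apply: (delta_le ray nd h_min F_neq0 yv); rewrite -subr_gt0.
have F_neq0 : [set x | Q eps s x /\ dot (u_ F) x = height F] !=set0.
  by exists x; split=> //; exact: memF.
(* A vertex off [F] must exist, or [delta] would be the default 0: releasing a facet through [F]
   leaves [F], and walking up along [u_ F] ends in such a vertex. *)
have [G fG FG] := proper_face_facet pF.
have [x1 [Qx1 x1G _]] := release g Qx fG.
have x1F : 0 < fslack F x1.
  apply: fslack_gt0 => //; first exact: QS.
  by move=> /FG/(facet_slack x1 fG)[_ G0]; rewrite G0 ltxx in x1G.
have [x2 [x2v x2u _]] := hpoly_walk (- u_ F) Qx1 ray.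
have [|y [yv y_gt0 ymin _]] := gap_vertex ray nd h_min F_neq0.
  exists x2 => //; rewrite -subr_gt0; apply: lt_le_trans x1F _.
  by rewrite lerD2r; move: x2u; rewrite !dotNl lerN2.
rewrite e_gt0 /=; apply: (@lt_le_trans _ _ (fslack F y)).
  by apply: gap; rewrite ?subr_gt0.
apply: (le_delta ray nd h_min F_neq0).
  by exists x1; [exact: Qx1 | rewrite -subr_gt0].
by move=> y' y'v y'_gt0; rewrite lerD2r ymin.
Qed.

(** [Tr] measures depth from the current polytope; since [F] still meets it, its support in the
    direction [u_ F] is still [height F]. *)
Lemma Tr_Q eps s F : gapped eps (rcons s F) ->
  Tr (eps F) (Q eps s) (u_ F) = Q eps (rcons s F).
Proof.
move=> /gapped_rcons[_ [pF [z Qz Fz] _ _]].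
have Sz : S z by case/QP: Qz.
have uz : dot (u_ F) z = height F.
  by move/(fslack0P pF Sz): Fz => /eqP; rewrite subr_eq0 => /eqP.
rewrite /Tr (support_argmin Qz) uz; last first.
  move=> x /QP[Sx _]; have := fslack_ge0 F Sx; by rewrite subr_ge0.
apply/seteqP; split=> x.
  by move=> [Qx xu]; apply/Q_rcons; split=> //; rewrite lerBrDl.
by move=> /Q_rcons[Qx]; rewrite lerBrDl.
Qed.

Lemma all_shallowP eps s1 s2 : gapped eps s1 ->
  (forall F, F \in s2 -> proper_face S F) ->
  all_shallow S nu eps (Q eps s1) s2 <-> gapped eps (s1 ++ s2).
Proof.
elim: s2 s1 => [|F s2 IH] s1 g ps; first by rewrite cats0.
have pF : proper_face S F by apply: ps; rewrite mem_head.
have ps2 G : G \in s2 -> proper_face S G by move=> Gs; apply: ps;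
  rewrite inE Gs orbT.
rewrite /= (shallowP g pF) -cat_rcons; split.
  move=> [gF]; have g' : gapped eps (rcons s1 F).
    by apply/gapped_rcons; split=> //; case: gF.
  by rewrite Tr_Q // IH.
move=> g2; have g' := gapped_cat g2; split.
  by have /gapped_rcons[_ []] := g'.
by rewrite Tr_Q // IH.
Qed.

Lemma truncate_Q eps s1 s2 : gapped eps (s1 ++ s2) ->
  truncate S nu eps (Q eps s1) s2 = Q eps (s1 ++ s2).
Proof.
elim: s2 s1 => [|F s2 IH] s1; first by rewrite cats0.
rewrite -cat_rcons => g2 /=; rewrite Tr_Q ?IH //.
exact: gapped_cat g2.
Qed.

(** The last cut is undone first. A point pushed into [F] has the facets of [F] tight, and these are
    constraints of [s1]; undoing the earlier cuts keeps them tight, so the point remains in [F]. *)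
Lemma expand_all eps s1 s2 x : gapped eps (s1 ++ s2) -> Q eps (s1 ++ s2) x ->
  exists z, [/\ Q eps s1 z,
    forall p, p \in constraints eps s1 -> act x p -> act z p &
    forall F, F \in s2 -> fslack F x = eps F -> F z].
Proof.
elim/last_ind: s2 x => [|s2 F IH] x; first by rewrite cats0; exists x.
rewrite -rcons_cat => g /Q_rcons[Qx xF].
have /gapped_rcons[gs [pF _ _ _]] := g.
have sub p : p \in constraints eps s1 -> p \in constraints eps (s1 ++ s2).
  by rewrite /constraints map_cat !mem_cat => /orP[]->; rewrite ?orbT.
have cutD G : G \in s2 -> cut eps G \in constraints eps (s1 ++ s2).
  by move=> Gs; rewrite !mem_cat map_f ?orbT // mem_cat Gs orbT.
have [xF'|xF'] := eqVneq (fslack F x) (eps F); last first.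
  have [z [Qz xz zs]] := IH x gs Qx; exists z; split=> // G.
  by rewrite mem_rcons inE => /orP[/eqP->|/zs//] xE; rewrite xE eqxx in xF'.
have [x' [Qx' Fx' xx']] : exists z, [/\ Q eps (s1 ++ s2) z, F z &
    forall p, p \in constraints eps (s1 ++ s2) -> act x p -> act z p].
  by apply: expand1 => //; rewrite xF'.
have [z [Qz xz zs]] := IH x' gs Qx'.
exists z; split=> //; first by move=> p pD xp; apply: xz => //;
  apply: xx' => //; exact: sub.
move=> G; rewrite mem_rcons inE => /orP[/eqP-> _|Gs2 xG].
  apply/(face_slackP z pF); split; first by case/QP: Qz.
  move=> G' fG' FG'; apply/eqP; rewrite -act_atom; apply: xz.
    by rewrite mem_cat mem_atom.
  by rewrite act_atom; apply/eqP;
    have [] := (facet_slack x' fG').1 (FG' x' Fx').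
apply: zs => //; apply/eqP; rewrite -act_cut; apply: xx'; first exact: cutD.
by rewrite act_cut xG.
Qed.

Lemma gapped0 eps : gapped eps [::].
Proof. by case. Qed.

(** If neither face were in [G], releasing [G] at [z] would keep all facets of both faces tight and
    still leave [G]. *)
Lemma facets_cap F1 F2 z G : proper_face S F1 -> proper_face S F2 ->
  F1 z -> F2 z -> G \in fs -> F1 `&` F2 `<=` G -> F1 `<=` G \/ F2 `<=` G.
Proof.
move=> pF1 pF2 F1z F2z fG FG; apply: contrapT => /not_orP[nF1 nF2].
have Qz : Q (fun=> 0) [::] z by rewrite Q_nil; exact: face_sub F1z.
have [x1 [Qx1 x1G Hx1]] := release (gapped0 _) Qz fG.
have Sx1 : S x1 by case/QP: Qx1.
have keep F : proper_face S F -> F z -> ~ F `<=` G -> F x1.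
  move=> pF Fz nFG; apply/(face_slackP x1 pF); split=> // G' fG' FG'.
  apply/eqP; rewrite -act_atom; apply: Hx1; first by rewrite mem_cat mem_atom.
    by apply: contra_notN nFG => /eqP/(atom_inj fG' fG) <-.
  by rewrite act_atom; apply/eqP; have [] := (facet_slack z fG').1 (FG' z Fz).
have /FG/(facet_slack x1 fG)[_ G0] : (F1 `&` F2) x1 by split; exact: keep.
by rewrite G0 ltxx in x1G.
Qed.

Lemma fslack_single F G x : G \in fs -> F `<=` G ->
  (forall G', G' \in fs -> F `<=` G' -> G' <> G -> slack G' x = 0) ->
  fslack F x = slack G x.
Proof.
move=> fG FG H; have GF : G \in facets_of F by apply/facets_ofP.
rewrite fslackE (bigD1_seq G GF (facets_of_uniq F)) /= big1_seq;
  first exact: addr0.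
move=> G' /andP[/eqP G'G /facets_ofP[fG' FG']].
exact: H fG' FG' G'G.
Qed.

Lemma vertex_gap eps s F : exists2 m, 0 < m & forall y,
  hvertex W o (constraints eps s) y -> 0 < fslack F y -> m <= fslack F y.
Proof.
pose X := [set y | hvertex W o (constraints eps s) y /\ 0 < fslack F y].
have [X0|none] := pselect (X !=set0); last first.
  by exists 1 => // y yv yF; case: none; exists y.
have XD : X `<=` hvertex W o (constraints eps s) by move=> y [].
have [y [yv y_gt0] ymin] := hvertex_argmin (fslack F) XD X0.
exists (fslack F y); first exact: y_gt0.
move=> z zv z_gt0; exact: ymin (conj zv z_gt0).
Qed.

Local Notation delta_ F := (delta S F (u_ F)).

(** Half of a lower bound for the positive values of [fslack F] at the vertices is a shallow depth,
    so [delta] exceeds it. *)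
Lemma delta_gt0 F : proper_face S F -> 0 < delta_ F.
Proof.
move=> pF; have [m m_gt0 mP] := vertex_gap (fun=> 0) [::] F.
have [x Fx] := face_neq0 pF.
have := (shallowP (eps := fun=> m / 2) (s := [::]) (gapped0 _) pF).2.
have -> : F `&` Q (fun=> m / 2) [::] = F.
  by rewrite Q_nil; apply/setIidl => y; exact: face_sub.
rewrite Q_nil /shallow => H; have /H /andP[] : [/\ exists2 x, S x & F x,
    0 < m / 2 & forall y, hvertex W o (constraints (fun=> m / 2) [::]) y ->
    0 < fslack F y -> m / 2 < fslack F y].
  split; [by exists x => //; exact: face_sub Fx | lra |].
  by move=> y yv y_gt0; have := mP y yv y_gt0; lra.
exact: lt_trans.
Qed.

Lemma delta_fslack F y : proper_face S F -> hvertex W o D0 y ->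
  0 < fslack F y ->
  delta_ F <= fslack F y.
Proof.
move=> pF yv y_gt0.
have := @delta_le _ _ W o D0 (u_ F) (height F).
rewrite -faceE // -SE; apply=> //.
- by move=> x Sx; have := fslack_ge0 F Sx; rewrite subr_ge0.
- by have [x Fx] := face_neq0 pF; exists x.
- by rewrite -subr_gt0.
Qed.

(** * Nested sets and tight cuts *)

Section BuildingSet.
Context (B : set (set V)).
Hypothesis buildB : building_set S B.

Let properB F : B F -> proper_face S F.
Proof. by case: buildB => + _ _; apply. Qed.

(* N is the set of tight faces of a point of some (every) B-truncation: the
   first clause is "N is a simplex", the second replaces the usual condition
   on antichains of N. *)
Definition nested (N : set (set V)) := (exists2 z, S z & forall J,
  N J -> J z) /\
  forall I, B I -> exists G, [/\ G \in fs, I `<=` G &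
    forall J, N J -> J `<=` G -> J `<=` I].

Lemma mem_listing s F : inclusion_listing B s -> F \in s <-> B F.
Proof. by move=> [_ sB _]; rewrite -sB. Qed.

(* If every facet containing I contained a tight J which is not inside I, the
   intersection U of I with these J would be in B and be truncated before them;
   undoing the later truncations gives a point of U violating that cut. *)
Lemma active_nested eps s x : inclusion_listing B s -> gapped eps s ->
  Q eps s x -> nested [set J | B J /\ fslack J x = eps J].
Proof.
move=> ls g Qx; have memB F := mem_listing F ls.
have [z [Qz _ zN]] := @expand_all eps [::] s x g Qx.
have Sz : S z by case/QP: Qz.
split; first by exists z => // J [BJ Jx]; apply: zN => //; exact/memB.
move=> I BI; apply: contrapT => none.
have cover G : G \in fs -> I `<=` G -> exists J, [/\ B J, fslack J x = eps J,
    J `<=` G & ~ J `<=` I].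
  move=> fG IG; apply: contrapT => none'; apply: none; exists G; split=> //.
  move=> J [BJ Jx] JG; apply: contrapT => nJI; apply: none'.
  by exists J.
pose A J := [/\ B J, fslack J x = eps J, ~ J `<=` I &
  exists G, [/\ G \in fs, I `<=` G & J `<=` G]].
have zA J : A J -> J z by move=> [BJ Jx _ _]; apply: zN => //; exact/memB.
have Iz : I z.
  apply/(face_slackP z (properB BI)); split=> // G fG IG.
  have [J [BJ Jx JG _]] := cover G fG IG.
  have Jz : J z by apply: zN => //; exact/memB.
  by have [] := (facet_slack z fG).1 (JG z Jz).
have [U [BU UI Uz UA UG]] : exists U, [/\ B U, U `<=` I, U z,
    forall J, A J -> U `<=` J & forall G, G \in fs -> U `<=` G ->
      I `<=` G \/ exists2 J, A J & J `<=` G].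
  suff H : forall l : seq (set V), (forall J, J \in l -> A J) ->
      exists U, [/\ B U, U `<=` I, U z,
      forall J, J \in l -> U `<=` J & forall G, G \in fs -> U `<=` G ->
        I `<=` G \/ exists2 J, A J & J `<=` G].
    have [|U [BU UI Uz UJ UG]] := H [seq J <- s | `[< A J >]].
      by move=> J; rewrite mem_filter => /andP[/asboolP].
    exists U; split=> // J AJ; apply: UJ; rewrite mem_filter.
    by apply/andP; split; [exact/asboolP | apply/memB; case: AJ].
  elim=> [_|J l IH lA].
    by exists I; split=> // G fG IG; left.
  have [|U [BU UI Uz UJ UG]] := IH.
    by move=> J' J'l; apply: lA; rewrite inE J'l orbT.
  have AJ : A J by apply: lA; rewrite mem_head.
  have Jz := zA J AJ; have [BJ _ _ [G0 [fG0 IG0 JG0]]] := AJ.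
  (* [U] remains inside [I], so the facet [G0] shared by [I] and [J] contains [U] as well; this is
     the common facet that the building set axiom asks for. *)
  exists (U `&` J); split=> //.
  - case: buildB => _ _; apply=> //; first by exists z.
    exists G0; split=> //; first exact/fsP.
    exact: subset_trans UI IG0.
  - by apply: subset_trans UI; exact: subIsetl.
  - move=> J'; rewrite inE => /orP[/eqP->|J'l]; first exact: subIsetr.
    by apply: subset_trans (UJ J' J'l); exact: subIsetl.
  - move=> G fG /(facets_cap (properB BU) (properB BJ) Uz Jz fG)[UG'|JG].
      exact: UG.
    by right; exists J.
have Us : U \in s by apply/memB.
have [s1 [s2 sE]] : exists s1 s2, s = s1 ++ U :: s2.
  by case/splitPr: Us => s1 s2; exists s1, s2.
have gU : gapped eps (rcons s1 U ++ s2) by rewrite cat_rcons -sE.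
have QU : Q eps (rcons s1 U ++ s2) x by rewrite cat_rcons -sE.
have [z' [Qz' _ z's2]] := expand_all gU QU.
have Az' J : A J -> J z'.
  move=> AJ; have [BJ Jx nJI _] := AJ; apply: z's2 => //.
  have : J \in s by apply/memB.
  rewrite {1}sE mem_cat inE => /orP[Js1|/orP[/eqP JU|//]]; last first.
    by rewrite JU in nJI.
  have [a [b s1E]] : exists a b, s1 = a ++ J :: b.
    by case/splitPr: Js1 => a b; exists a, b.
  have sE' : s = a ++ J :: (b ++ U :: s2) by rewrite sE s1E -catA.
  have /(_ U) := listing_after ls sE'; rewrite mem_cat mem_head orbT.
  by move=> /(_ isT) []; exact: UA.
have [_ _ eU _] := g s1 U s2 sE.
have [Qz1 zU] := (Q_rcons _ _ _ _).1 Qz'.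
have Sz' : S z' by case/QP: Qz1.
have : fslack U z' = 0.
  apply/(fslack_eq0 U Sz') => G fG UG'.
  suff [J AJ JG] : exists2 J, A J & J `<=` G.
    by have [] := (facet_slack z' fG).1 (JG z' (Az' J AJ)).
  have [IG|//] := UG G fG UG'; have [J [BJ Jx JG nJI]] := cover G fG IG.
  by exists J => //; split=> //; exists G.
by move=> U0; rewrite U0 leNgt eU in zU.
Qed.

(** When [I] is cut, release the facet [G] that nestedness assigns to [I]. A member of [N] inside
    [G] is inside [I], hence not listed later, so the release disturbs no later member. Walking up
    along [u_ I] then passes the cut at a vertex [y]. If [I] is in [N], the point of the segment
    from [x] to [y] at depth [eps I] is the one sought; otherwise [y] is. *)
Lemma realize eps s s1 s2 N : inclusion_listing B s -> s = s1 ++ s2 ->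
  gapped eps s1 -> N `<=` B -> nested N ->
  exists x, [/\ Q eps s1 x, forall J, N J -> J \in s1 -> fslack J x = eps J &
    forall J, N J -> J \in s2 -> J x].
Proof.
move=> ls + + NB [[z Sz zN] Nnest].
elim/last_ind: s1 s2 => [|s1 I IH] s2.
  by exists z; rewrite Q_nil; split=> // J NJ _; exact: zN.
rewrite cat_rcons => sE g; have /gapped_rcons[gs [pI _ eI gap]] := g.
have [x [Qx xs1 xs2]] := IH (I :: s2) sE gs.
have memB F := mem_listing F ls.
have BI : B I by apply/memB; rewrite sE mem_cat mem_head orbT.
have [G [fG IG GN]] := Nnest I BI.
have Sx : S x by case/QP: Qx.
have s2_G J : N J -> J \in s2 -> ~ J `<=` G.
  by move=> NJ Js2 /(GN J NJ); exact: listing_after ls sE Js2.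
have atomG J : N J -> J \in s1 -> cut eps J <> atom G.
  move=> NJ Js1 [uJ hJ]; have BJ : B J by exact: NB.
  have [y Jy] := face_neq0 (properB BJ).
  have Sy := face_sub (properB BJ) Jy.
  have : fslack J y = 0 by apply/fslack0P => //; exact: properB.
  rewrite /fslack uJ => y0; have := slack_ge0 fG Sy; rewrite /slack -hJ.
  have : 0 < eps J.
    have [a [b s1E]] : exists a b, s1 = a ++ J :: b.
      by case/splitPr: Js1 => a b; exists a, b.
    by have [] := gs a J b s1E.
  by move: y0; lra.
have [x1 [Qx1 x1G Hx1]] := release gs Qx fG.
have Sx1 : S x1 by case/QP: Qx1.
have x1I : 0 < fslack I x1.
  apply: fslack_gt0 => // /IG/(facet_slack x1 fG)[_ G0].
  by rewrite G0 ltxx in x1G.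
have [y [yv yu x1y]] := hpoly_walk (- u_ I) Qx1 (@Q_ray eps s1).
have Qy : Q eps s1 y by case: yv.
have Sy : S y by case/QP: Qy.
have yI : eps I < fslack I y.
  apply: gap => //; apply: lt_le_trans x1I _.
  by rewrite lerD2r; move: yu; rewrite !dotNl lerN2.
have ys1 J : N J -> J \in s1 -> fslack J y = eps J.
  move=> NJ Js1; apply/eqP; rewrite -act_cut.
  have cD : cut eps J \in constraints eps s1 by rewrite mem_cat map_f ?orbT.
  apply: x1y => //; apply: Hx1 => //; first exact/eqP/atomG.
  by rewrite act_cut xs1.
have ys2 J : N J -> J \in s2 -> J y.
  move=> NJ Js2; have BJ : B J by exact: NB.
  apply/(face_slackP y (properB BJ)); split=> // G' fG' JG'.
  have aD : atom G' \in constraints eps s1 by rewrite mem_cat mem_atom.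
  apply/eqP; rewrite -act_atom; apply: x1y => //; apply: Hx1 => //.
    apply/eqP => /(atom_inj fG' fG) G'E; rewrite G'E in JG'.
    exact: s2_G JG'.
  rewrite act_atom; apply/eqP; have Jx : J x by apply: xs2;
    rewrite // inE Js2 orbT.
  by have [] := (facet_slack x fG').1 (JG' x Jx).
have [NI|nNI] := pselect (N I); last first.
  exists y; split=> //; first by apply/Q_rcons; split=> //; exact: ltW.
  by move=> J NJ; rewrite mem_rcons inE => /orP[/eqP JI|];
    [rewrite JI in NJ | exact: ys1].
have Ix : I x by apply: xs2 => //; rewrite mem_head.
have xI : fslack I x = 0 by apply/fslack0P.
pose t := eps I / fslack I y.
have y_gt0 : 0 < fslack I y by exact: lt_trans eI yI.
have t_gt0 : 0 < t by rewrite divr_gt0.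
have t_lt1 : t < 1 by rewrite ltr_pdivrMr // mul1r.
have tE : t * fslack I y = eps I by rewrite divfK // gt_eqF.
have fslackz F : fslack F (x + t *: (y - x)) =
  fslack F x + t * (fslack F y - fslack F x).
  by rewrite fslack_lin dotBr /fslack; ring.
have Qz : Q eps s1 (x + t *: (y - x)).
  by apply: hpoly_convex => //; rewrite !ltW.
have Sz' : S (x + t *: (y - x)) by case/QP: Qz.
have zI : fslack I (x + t *: (y - x)) =
  eps I by rewrite fslackz xI subr0 tE add0r.
exists (x + t *: (y - x)); split.
- by apply/Q_rcons; split=> //; rewrite zI.
- move=> J NJ; rewrite mem_rcons inE => /orP[/eqP->//|Js1].
  by rewrite fslackz xs1 // ys1 // subrr mulr0 addr0.
- move=> J NJ Js2; have pJ := properB (NB J NJ).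
  have Jx : J x by apply: xs2; rewrite // inE Js2 orbT.
  apply/(fslack0P pJ Sz'); rewrite fslackz.
  rewrite ((fslack0P pJ Sx).2 Jx) ((fslack0P pJ Sy).2 (ys2 J NJ Js2)).
  by rewrite subrr mulr0 addr0.
Qed.

(** Only the facet [G] of [I] is released. A member of [N] not inside [I] is not inside [G] and
    stays at 0; for one inside [I], all of [fslack] comes from [G], as it does for [I] itself, so
    both reach [delta] at the same point of the segment. *)
Lemma deep_point I N : B I -> N `<=` B -> nested N ->
  exists z, [/\ S z, delta_ I <= fslack I z &
    forall J, N J -> fslack J z = if `[< J `<=` I >] then delta_ I else 0].
Proof.
move=> BI NB [[z0 Sz0 zN] Nnest]; have pI := properB BI.
have [G [fG IG GN]] := Nnest I BI.
have Qz0 : Q (fun=> 0) [::] z0 by rewrite Q_nil.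
have [x1 [Qx1 x1G Hx1]] := release (gapped0 _) Qz0 fG.
have Sx1 : S x1 by case/QP: Qx1.
have x1I : 0 < fslack I x1.
  apply: fslack_gt0 => // /IG/(facet_slack x1 fG)[_ G0].
  by rewrite G0 ltxx in x1G.
have [y [yv yu x1y]] := hpoly_walk (- u_ I) Qx1 (@Q_ray (fun=> 0) [::]).
have Sy : S y by case: yv => /QP[].
have y_gt0 : 0 < fslack I y.
  apply: lt_le_trans x1I _.
  by rewrite lerD2r; move: yu; rewrite !dotNl lerN2.
have yI : delta_ I <= fslack I y.
  by apply: delta_fslack => //; move: yv; rewrite /constraints cats0.
have yact G' : G' \in fs -> G' <> G -> slack G' z0 = 0 -> slack G' y = 0.
  move=> fG' G'G z0G'; have aD : atom G' \in constraints (fun=> 0) [::].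
    by rewrite mem_cat mem_atom.
  apply/eqP; rewrite -act_atom; apply: x1y => //; apply: Hx1 => //.
    by apply/eqP => /(atom_inj fG' fG).
  by rewrite act_atom z0G'.
have z0J J G' : N J -> G' \in fs -> J `<=` G' -> slack G' z0 = 0.
  by move=> NJ fG' JG'; have [] := (facet_slack z0 fG').1 (JG' _ (zN J NJ)).
have fslack_z0 J : N J -> fslack J z0 = 0.
  by move=> NJ; apply/fslack0P => //; [apply/properB/NB | exact: zN].
have fslack_y J : N J -> ~ J `<=` I -> fslack J y = 0.
  move=> NJ JI; apply/(fslack_eq0 J Sy) => G' fG' JG'.
  by apply: yact => //; [move=> G'E; apply/JI/GN;
    rewrite -?G'E | exact: z0J JG'].
(* Without a member of [N] inside [I], the starting point [z0] need not lie on [I], and the vertex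
   [y] itself serves. *)
have [[J0 NJ0 J0I]|none] := pselect (exists2 J, N J & J `<=` I); last first.
  exists y; split=> // J NJ; case: asboolP => [JI|]; last exact: fslack_y.
  by case: none; exists J.
have Iz0 : I z0 := J0I _ (zN _ NJ0).
have fslackIz0 : fslack I z0 = 0 by apply/fslack0P.
have fslack_yI J : J `<=` I -> J z0 -> fslack J y = slack G y.
  move=> JI Jz0; apply: fslack_single => // [|G' fG' JG' G'G].
    exact: subset_trans JI IG.
  apply: yact => //.
  by have [] := (facet_slack z0 fG').1 (JG' _ Jz0).
have yG : slack G y = fslack I y by rewrite fslack_yI.
pose t := delta_ I / fslack I y.
have t_gt0 : 0 < t by rewrite divr_gt0 // delta_gt0.
have t_le1 : t <= 1 by rewrite ler_pdivrMr // mul1r.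
have tE : t * fslack I y = delta_ I by rewrite divfK // gt_eqF.
have fslackz F : fslack F (z0 + t *: (y - z0)) =
  fslack F z0 + t * (fslack F y - fslack F z0).
  by rewrite fslack_lin dotBr /fslack; ring.
exists (z0 + t *: (y - z0)); split.
- move: Sz0 Sy; rewrite !SP => Sz0' Sy'.
  by apply: hpoly_convex => //; rewrite ltW.
- by rewrite fslackz fslackIz0 subr0 tE add0r.
- move=> J NJ; rewrite fslackz fslack_z0 // subr0 add0r.
  case: asboolP => JI; last by rewrite fslack_y // mulr0.
  by rewrite fslack_yI // ?yG //; exact: zN.
Qed.

Lemma nested_single J : B J -> nested [set J].
Proof.
move=> BJ; have pJ := properB BJ; split.
  have [z Jz] := face_neq0 pJ; exists z; first exact: face_sub Jz.
  by move=> _ ->.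
move=> I BI; have pI := properB BI.
have [[G [fG IG JG]]|none] := pselect (exists G, [/\ G \in fs,
  I `<=` G & ~ J `<=` G]).
  by exists G; split=> // J' -> /JG.
have [G fG IG] := proper_face_facet pI; exists G; split=> // J' -> _ x Jx.
apply/(face_slackP x pI); split; first exact: face_sub Jx.
move=> G' fG' IG'; have [|//] := (facet_slack x fG').1 _.
suff JG' : J `<=` G' by exact: JG' Jx.
by apply: contrapT => nJG'; apply: none; exists G'.
Qed.

Lemma nested_set0 : nested set0.
Proof.
split; first by exists o.
by move=> I BI; have [G fG IG] := proper_face_facet (properB BI); exists G.
Qed.

(** * Vertices created by a cut, and the choice of the depths *)

Lemma exit_vertex eps s F y v : hvertex W o (constraints eps (rcons s F)) y ->
  v \in W -> dot (u_ F) v != 0 ->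
  (forall p, p \in constraints eps s -> act y p -> dot p.1 v = 0) ->
  exists t, 0 < t /\ hvertex W o (constraints eps s) (y + t *: v).
Proof.
move=> [/Q_rcons[Qy _] yv] vW uv Hv.
have v0 : v != 0 by apply: contraNneq uv => ->; rewrite dot0r.
have [|t [p1 [t0 Qy' p1D p1v p1y']]] := hpoly_exit Qy (@Q_ray eps s) vW v0.
  by move=> p pD yp; rewrite Hv.
exists t; split=> //; split=> // w wW Hw.
have wE : w = (dot (u_ F) w / dot (u_ F) v) *: v.
  apply/eqP; rewrite -subr_eq0; apply/eqP; apply: yv.
    by rewrite rpredB // rpredZ.
  move=> p; rewrite mem_constraints_rcons dotBr dotZr => /orP[/eqP-> _|pD yp].
    by rewrite /= divfK // subrr.
  rewrite (Hv p pD yp) mulr0 subr0; apply: Hw => //.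
  by rewrite /act dot_lin Hv // mulr0 addr0.
have /eqP := Hw p1 p1D p1y'; rewrite {1}wE dotZr mulf_eq0 (lt_eqF p1v) orbF.
by move=> /eqP c0; rewrite wE c0 scale0r.
Qed.

(** The vector dual to the new cut spans an old edge through [y]. Its lower end is an old vertex at
    depth less than [eps F], which the gap puts on [F]. *)
Lemma vertex_rcons eps s F y : gapped eps (rcons s F) ->
  hvertex W o (constraints eps (rcons s F)) y ->
  hvertex W o (constraints eps s) y \/
  exists x1 x2, [/\ hvertex W o (constraints eps s) x1,
    hvertex W o (constraints eps s) x2, F x1, eps F < fslack F x2 &
    y = x1 + (eps F / fslack F x2) *: (x2 - x1)].
Proof.
move=> g yv; have /gapped_rcons[gs [pF _ eF gap]] := g.
have Qry : Q eps (rcons s F) y by case: yv.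
have [Qy yF] := (Q_rcons eps s F y).1 Qry.
have [yF'|yF'] := eqVneq (fslack F y) (eps F); last first.
  left; split=> // v vW Hv; apply: yv.2 => // p.
  rewrite mem_constraints_rcons => /orP[/eqP->|]; last exact: Hv.
  by rewrite act_cut (negPf yF').
(* An old constraint might coincide with the new cut as a pair; it would then remain tight at a
   point of [F], where [fslack F] is 0. *)
right; have ncut p : p \in constraints eps s -> act y p -> p != cut eps F.
  move=> pD yp; have [z [Qz Fz yz]] : exists z, [/\ Q eps s z, F z &
      forall p, p \in constraints eps s -> act y p -> act z p].
    by apply: expand1 => //; rewrite yF'.
  apply: contraTneq (yz p pD yp) => ->; rewrite act_cut.
  have Sz : S z by case/QP: Qz.
  by rewrite ((fslack0P pF Sz).2 Fz) lt_eqF.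
have [v vW Hv] := nondeg_Q g Qry (fun p => (p == cut eps F)%:R).
have uv : dot (u_ F) v = 1.
  have := Hv (cut eps F); rewrite mem_constraints_rcons eqxx act_cut yF' eqxx.
  exact.
have Hv0 p : p \in constraints eps s -> act y p -> dot p.1 v = 0.
  move=> pD yp; rewrite Hv ?(negPf (ncut p pD yp)) //.
  by rewrite mem_constraints_rcons pD orbT.
have [||||t2 [t2_gt0 x2v]] := @exit_vertex eps s F y v => //.
  by rewrite uv oner_eq0.
have [|||t1 [t1_gt0 x1v]] := @exit_vertex eps s F y (- v) yv.
- by rewrite rpredN.
- by rewrite dotNr uv oppr_eq0 oner_eq0.
- by move=> p pD yp; rewrite dotNr Hv0 // oppr0.
exists (y + t1 *: - v), (y + t2 *: v).
have x2F : fslack F (y + t2 *: v) =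
  eps F + t2 by rewrite fslack_lin yF' uv mulr1.
have x1F : fslack F (y + t1 *: - v) = eps F - t1.
  by rewrite fslack_lin yF' dotNr uv mulrN1.
have Qx1 : Q eps s (y + t1 *: - v) by case: x1v.
have Sx1 : S (y + t1 *: - v) by case/QP: Qx1.
have t1E : t1 = eps F.
  have := fslack_ge0 F Sx1; have := gap _ x1v; rewrite x1F; lra.
have t2E : 0 < eps F + t2 by rewrite addr_gt0.
split=> //.
- by apply/(fslack0P pF Sx1); rewrite x1F t1E subrr.
- by rewrite x2F; lra.
- rewrite x2F t1E; have -> : y + t2 *: v - (y + eps F *: - v) =
  (eps F + t2) *: v.
    by rewrite opprD scalerN opprK addrACA subrr add0r scalerDl addrC.
  by rewrite scalerA divfK ?gt_eqF // scalerN subrK.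
Qed.

Lemma slack_vertex_bound : exists2 m, 0 < m & forall y G,
  hvertex W o D0 y -> G \in fs -> 0 < slack G y -> m <= slack G y.
Proof.
have [G|m m_gt0 mP] := @seq_eps R _ fs (fun G t => forall y, hvertex W o D0 y ->
    0 < slack G y -> t <= slack G y).
  move=> _; pose X := [set y | hvertex W o D0 y /\ 0 < slack G y].
  have [X0|none] := pselect (X !=set0); last first.
    by exists 1 => // t _ y yv yG; case: none; exists y.
  have XD : X `<=` hvertex W o D0 by move=> y [].
  have [y [yv y_gt0] ymin] := hvertex_argmin (slack G) XD X0.
  exists (slack G y); first exact: y_gt0.
  move=> t /andP[_ ty] z zv z_gt0; apply: le_trans ty _.
  exact: ymin (conj zv z_gt0).
exists m => // y G yv fG; apply: (mP G m fG _ y yv).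
by rewrite lexx ltW.
Qed.

Lemma fslack_ge_slack F G x : S x -> G \in fs -> F `<=` G ->
  slack G x <= fslack F x.
Proof.
move=> Sx fG FG; have GF : G \in facets_of F by apply/facets_ofP.
rewrite fslackE (bigD1_seq G GF (facets_of_uniq F)) /= lerDl big_seq_cond.
apply: sumr_ge0 => G' /andP[/facets_ofP[fG' _] _]; exact: slack_ge0.
Qed.

Definition in_box (a b eps : set V -> R) s :=
  forall F, F \in s -> a F < eps F < b F.

(* m bounds below the nonzero slacks at the vertices: a new vertex lies on an
   edge from F to a vertex x2, at fraction eps F / fslack F x2 of it, so the
   bound is multiplied by at least c / (2 M). The reserve r keeps the sums of
   later depths below the earlier ones. *)
Lemma box s s1 s2 : inclusion_listing B s -> s = s1 ++ s2 ->
  exists a b m r, [/\ 0 < m, 0 < r, forall F, F \in s1 -> 0 < a F < b F,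
    forall eps, in_box a b eps s1 -> gapped eps s1 /\
      forall y G, hvertex W o (constraints eps s1) y -> G \in fs ->
        0 < slack G y -> m <= slack G y &
    (forall t1 F t2, s1 = t1 ++ F :: t2 -> \sum_(G <- t2) b G + r <= a F) /\
    \sum_(F <- s1) b F / delta_ F + r <= 1].
Proof.
move=> ls; have [us _ _] := ls; elim/last_ind: s1 s2 => [|s1 F IH] s2.
  move=> _; have [m m_gt0 mP] := slack_vertex_bound.
  exists (fun=> 0), (fun=> 0), m, 1; split=> //.
    move=> eps _; split; first exact: gapped0.
    by move=> y G; rewrite /constraints cats0; exact: mP.
  by split=> [[]//|]; rewrite big_nil add0r.
rewrite cat_rcons => sE; have [a [b [m [r [m_gt0 r_gt0 ab_gt0 abP [abr r1]]]]]]
  := IH _ sE.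
have memB J := mem_listing J ls.
have BF : B F by apply/memB; rewrite sE mem_cat mem_head orbT.
have pF := properB BF; have dF := delta_gt0 pF.
have Fs1 : F \notin s1.
  move: us; rewrite sE cat_uniq /= negb_or => /and3P[_ /andP[] + _ _].
  by [].
have neF J : J \in s1 -> (J == F) = false.
  by move=> Js1; apply: contraNF Fs1 => /eqP <-.
have [M0 HM0] : exists M, forall x, S x -> fslack F x <= M.
  have [M HM] := bdS (u_ F); exists (M - height F) => x Sx.
  by rewrite /fslack lerD2r HM.
pose M := Num.max 1 M0; have M_ge1 : 1 <= M by rewrite le_max lexx.
have HM x : S x -> fslack F x <= M by move=> /HM0 xM; rewrite le_max xM orbT.
(* The bound [m / 2] makes the cut shallow and puts new vertices in the lower half of their edges;
   the two others spend half of the reserve, on the sums of depths and on the sum of the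
   [b F / delta_ F]. *)
pose c := Num.min (m / 2) (Num.min (r / 2) (r / 2 * delta_ F)).
have m2 : 0 < m / 2 by lra.
have r2 : 0 < r / 2 by lra.
have c_gt0 : 0 < c by rewrite !lt_min m2 r2 mulr_gt0.
have c_m : c <= m / 2 by rewrite ge_min lexx.
have c_r : c <= r / 2 by rewrite !ge_min lexx !orbT.
have c_d : c / delta_ F <= r / 2 by rewrite ler_pdivrMr // !ge_min lexx !orbT.
pose a' J := if J == F then c / 2 else a J.
pose b' J := if J == F then c else b J.
have b'E t : {subset t <= s1} -> \sum_(G <- t) b' G = \sum_(G <- t) b G.
  by move=> ts; rewrite !big_seq; apply: eq_bigr => G /ts/neF GF;
    rewrite /b' GF.
have M_gt0 : 0 < M by lra.
pose m' := Num.min m (m * (c / 2) / M).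
exists a', b', m', (Num.min (r / 2) (c / 2)); split.
- by rewrite lt_min m_gt0 divr_gt0 // mulr_gt0 // divr_gt0.
- by rewrite lt_min !divr_gt0.
- move=> J; rewrite mem_rcons inE => /orP[/eqP->|Js1].
    by rewrite /a' /b' eqxx; apply/andP; split; lra.
  by rewrite /a' /b' neF // ab_gt0.
- move=> eps eps_in.
  have eps_s1 : in_box a b eps s1.
    move=> J Js1; have := eps_in J; rewrite mem_rcons inE Js1 orbT => /(_ isT).
    by rewrite /a' /b' neF.
  have /andP[aF bF] : c / 2 < eps F < c.
    have := eps_in F; rewrite mem_rcons mem_head => /(_ isT).
    by rewrite /a' /b' eqxx.
  have [gs vs] := abP eps eps_s1.
  have eF : 0 < eps F by lra.
  have gap y : hvertex W o (constraints eps s1) y -> 0 < fslack F y ->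
    m <= fslack F y.
    move=> yv y_gt0; have Sy : S y by case: yv => /QP[].
    have [G [fG FG yG]] : exists G, [/\ G \in fs, F `<=` G & slack G y != 0].
      apply: contrapT => none; have : fslack F y = 0.
        apply/fslack_eq0 => // G fG FG; apply/eqP/negPn/negP => yG.
        by apply: none; exists G.
      by move=> y0; rewrite y0 ltxx in y_gt0.
    apply: le_trans (fslack_ge_slack Sy fG FG); apply: vs => //.
    by rewrite lt_neqAle slack_ge0 // eq_sym yG.
  have g : gapped eps (rcons s1 F).
    apply/gapped_rcons; split=> //; split=> //.
      (* That the earlier cuts have not removed [F] is [realize] for the nested set [{F}]. *)
      have [|x [Qx _ xF]] := realize ls sE gs _ (nested_single BF).
        by move=> _ ->.
      by exists x => //; apply: xF => //; rewrite mem_head.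
    by move=> y yv y_gt0; have := gap y yv y_gt0; lra.
  split=> // y G yv fG yG; have [/vs mG|] := vertex_rcons g yv.
    by rewrite ge_min mG.
  move=> [x1 [x2 [x1v x2v Fx1 x2F yE]]].
  have x2_gt0 : 0 < fslack F x2 by exact: lt_trans eF x2F.
  have Sx1 : S x1 by case: x1v => /QP[].
  have Sx2 : S x2 by case: x2v => /QP[].
  have x2m := gap x2 x2v x2_gt0; have x2M := HM x2 Sx2.
  pose t := eps F / fslack F x2.
  have tE : t * fslack F x2 = eps F by rewrite divfK // gt_eqF.
  have t_ge : c / 2 / M <= t.
    rewrite ler_pdivrMr // /t mulrAC ler_pdivlMr //.
    by apply: ler_pM; rewrite ?divr_ge0 // ?ltW // ltW.
  have t_half : t <= 2^-1 by nra.
  have M_half : c / 2 / M <= 2^-1 by exact: le_trans t_ge t_half.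
  have yGE : slack G y = (1 - t) * slack G x1 + t * slack G x2.
    by rewrite yE slack_lin dotBr /slack -/t; ring.
  have := slack_ge0 fG Sx1; have := slack_ge0 fG Sx2.
  have m'E : m' <= m * (c / 2 / M) by rewrite ge_min mulrA lexx orbT.
  have cM : 0 < c / 2 / M by rewrite !divr_gt0.
  (* Both ends have weight at least [c / 2 / M], namely [t] and [1 - t >= 2^-1], and an end with
     nonzero slack has slack at least [m]. *)
  rewrite !le_eqVlt => /orP[/eqP x2G|x2G] /orP[/eqP x1G|x1G].
  + by move: yG; rewrite yGE -x1G -x2G !mulr0 addr0 ltxx.
  + by have := vs _ _ x1v fG x1G; rewrite yGE -x2G; nra.
  + by have := vs _ _ x2v fG x2G; rewrite yGE -x1G; nra.
  + have := vs _ _ x2v fG x2G; rewrite yGE => ?.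
    have : 0 <= (1 - t) * slack G x1 by rewrite mulr_ge0 // ?ltW //; lra.
    nra.
have rc1 : Num.min (r / 2) (c / 2) <= r / 2 by rewrite ge_min lexx.
have rc2 : Num.min (r / 2) (c / 2) <= c / 2 by rewrite ge_min lexx orbT.
split; last first.
  rewrite -cats1 big_cat big_seq1 /= {2}/b' eqxx.
  have -> : \sum_(G <- s1) b' G / delta_ G = \sum_(G <- s1) b G / delta_ G.
    by rewrite !big_seq; apply: eq_bigr => G /neF GF; rewrite /b' GF.
  by lra.
move=> t1 J t2; case: (lastP t2) => [|t2' H].
  rewrite cats1 => /rcons_inj[_ <-].
  by rewrite big_nil add0r /a' eqxx.
rewrite -rcons_cons -rcons_cat => /rcons_inj[s1E <-].
rewrite -cats1 big_cat big_seq1 /= {2}/b' eqxx b'E; last first.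
  by move=> G Gt; rewrite s1E mem_cat inE Gt !orbT.
have := abr _ _ _ s1E; rewrite /a' neF;
  last by rewrite s1E mem_cat mem_head orbT.
by lra.
Qed.

(** Sorting by decreasing number of facets works because a strictly smaller face lies in strictly
    more facets. *)
Lemma listing_exists : finite_set B -> exists s, inclusion_listing B s.
Proof.
move=> /finite_seqP[s0 BE].
pose key F := size (facets_of F).
pose le F G := (key G <= key F)%N.
have le_total : total le by move=> F G; exact: leq_total.
have le_trans' : transitive le by move=> F G H FG GH; exact: leq_trans GH FG.
have le_refl : reflexive le by move=> F; exact: leqnn.
pose s := sort le (undup s0).
have memB F : F \in s <-> B F by rewrite mem_sort mem_undup BE.
exists s; split.
- by rewrite sort_uniq undup_uniq.
- by apply/seteqP; split=> F /memB.
move=> i j si sj [ij nji]; rewrite ltnNge; apply/negP => le_ji.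
have := sorted_leq_nth le_trans' le_refl set0 (sort_sorted le_total _) j i sj
  si le_ji.
rewrite -/s /le leqNgt => /negP; apply; rewrite /key !size_filter.
have Bi : B (nth set0 s i) by apply/memB/mem_nth.
have Bj : B (nth set0 s j) by apply/memB/mem_nth.
have [G [fG iG jG]] : exists G, [/\ G \in fs, nth set0 s i `<=` G &
    ~ nth set0 s j `<=` G].
  apply: contrapT => none; apply: nji => x jx.
  apply/(face_slackP x (properB Bi)); split;
    first exact: face_sub (properB Bj) jx.
  move=> G fG iG; have [|//] := (facet_slack x fG).1 _.
  suff jG : nth set0 s j `<=` G by exact: jG.
  by apply: contrapT => njG; apply: none; exists G.
apply: (count_lt fG); [exact/asboolP | exact/asboolPn |].
by move=> H _ /asboolP jH; apply/asboolP; exact: subset_trans ij jH.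
Qed.

(** * Support functions on the normal fan of a truncation *)

Lemma act_atom_Q eps s x G : inclusion_listing B s -> gapped eps s ->
  Q eps s x -> G \in fs -> act x (atom G) = false.
Proof.
(* Facets are in [B], so each facet inequality is superseded by a cut of positive depth; on a full
   truncation only cuts can be tight. *)
move=> ls g Qx fG; have BG : B G by case: buildB => _ + _; apply; exact/fsP.
have [Sx xs] := (QP eps s x).1 Qx.
have Gs : G \in s by apply/(mem_listing G ls).
have [s1 [s2 sE]] : exists s1 s2, s = s1 ++ G :: s2.
  by case/splitPr: Gs => s1 s2; exists s1, s2.
have [pG _ eG _] := g s1 G s2 sE.
rewrite act_atom; apply/eqP => xG.
have : fslack G x = 0 by apply/(fslack0P pG Sx)/(facet_slack x fG).
by move=> x0; have := xs G Gs; rewrite x0 leNgt eG.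
Qed.

Lemma Q_tight eps s N : inclusion_listing B s -> gapped eps s -> N `<=` B ->
  nested N -> exists2 x, Q eps s x & forall J, N J -> fslack J x = eps J.
Proof.
move=> ls g NB nN; have [|x [Qx xs _]] := realize (s2 := [::]) ls _ g NB nN.
  by rewrite cats0.
by exists x => // J NJ; apply: xs => //; apply/(mem_listing J ls)/NB.
Qed.

(** A criterion for the support function of [X] to be linear on the cones of every [B]-truncation
    ([fan_linear]). *)
Definition nested_minima (X : set V) := X `<=` S /\
  forall N, N `<=` B -> nested N -> exists2 z, X z &
    forall J x, N J -> X x -> fslack J z <= fslack J x.

Lemma nested_minima_Q eps s : inclusion_listing B s -> gapped eps s ->
  nested_minima (Q eps s).
Proof.
move=> ls g; split=> [x /QP[]//|N NB nN].
have [z Qz zN] := Q_tight ls g NB nN; exists z => // J x NJ /QP[_ xs].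
by rewrite zN //; apply: xs; apply/(mem_listing J ls)/NB.
Qed.

Lemma nested_minima_S : nested_minima S.
Proof.
split=> // N NB [[z Sz zN] _]; exists z => // J x NJ Sx.
have -> : fslack J z = 0 by apply/fslack0P => //;
  [exact/properB/NB | exact: zN].
exact: fslack_ge0.
Qed.

Lemma DTrP I x : B I -> DTr S I (u_ I) x <-> S x /\ delta_ I <= fslack I x.
Proof.
move=> BI; have pI := properB BI; have [z Iz] := face_neq0 pI.
have Sz := face_sub pI Iz; have /eqP := (fslack0P pI Sz).2 Iz.
rewrite subr_eq0 => /eqP uz.
have suppE : support S (u_ I) = height I.
  by rewrite (support_argmin Sz) ?uz // => y /(fslack_ge0 I); rewrite subr_ge0.
by rewrite /DTr /Tr /= suppE /fslack lerBrDl.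
Qed.

Lemma fslack_mono I J x : S x -> J `<=` I -> fslack I x <= fslack J x.
Proof.
move=> Sx JI; rewrite !fslackE !big_filter big_mkcond [leRHS]big_mkcond /=.
rewrite big_seq [leRHS]big_seq; apply: ler_sum => G fG.
case: asboolP => [IG|_]; last by case: ifP => // _; exact: slack_ge0.
by case: asboolP => // -[]; exact: subset_trans JI IG.
Qed.

Lemma nested_minima_DTr I : B I -> nested_minima (DTr S I (u_ I)).
Proof.
move=> BI; split=> [x /(DTrP x BI)[]//|N NB nN].
have [z [Sz zI zN]] := deep_point BI NB nN.
exists z => [|J x NJ /(DTrP x BI)[Sx xI]]; first exact/DTrP.
rewrite zN //; case: asboolP => [JI|_]; last exact: fslack_ge0.
exact: le_trans xI (fslack_mono Sx JI).
Qed.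

Lemma support_fslack X J z : X z -> (forall x,
  X x -> fslack J z <= fslack J x) ->
  support X (u_ J) = height J + fslack J z.
Proof.
move=> Xz zmin; rewrite (support_argmin Xz) ?/fslack ?subrKC //.
by move=> x /zmin; rewrite lerD2r.
Qed.

Lemma support_Q eps s J : inclusion_listing B s -> gapped eps s -> B J ->
  support (Q eps s) (u_ J) = height J + eps J.
Proof.
move=> ls g BJ; have [|x Qx xJ] := Q_tight ls g _ (nested_single BJ).
  by move=> _ ->.
rewrite (support_fslack Qx) xJ // => y /QP[_ ys].
by apply: ys; apply/(mem_listing J ls).
Qed.

Lemma support_S J : B J -> support S (u_ J) = height J.
Proof.
move=> BJ; have pJ := properB BJ; have [z Jz] := face_neq0 pJ.
have Sz := face_sub pJ Jz; have z0 := (fslack0P pJ Sz).2 Jz.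
rewrite (support_fslack Sz) z0 ?addr0 // => x; exact: fslack_ge0.
Qed.

Lemma support_DTr I J : B I -> B J -> support (DTr S I (u_ I)) (u_ J) =
  height J + if `[< J `<=` I >] then delta_ I else 0.
Proof.
move=> BI BJ.
have [|z [Sz zI zN]] := deep_point BI _ (nested_single BJ);
  first by move=> _ ->.
have Xz : DTr S I (u_ I) z by apply/DTrP.
rewrite (support_fslack (J := J) Xz) zN // => x /(DTrP x BI)[Sx xI].
case: asboolP => [JI|_]; last exact: fslack_ge0.
exact: le_trans xI (fslack_mono Sx JI).
Qed.

Lemma sub_diff x y : S x -> S y -> x - y \in W.
Proof. by rewrite !SP; exact: hpoly_diff. Qed.

(** All of [C] is minimized at one vertex [x], whose tight constraints are cuts of a nested set. A
    point of [X] that is minimal for these cuts at once is minimal for every element of [C]. *)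
Lemma fan_linear eps s X C : inclusion_listing B s -> gapped eps s ->
  nested_minima X -> normal_fan (Q eps s) C -> exists2 z, X z &
    forall u, C u -> support X u = dot u z.
Proof.
move=> ls g [XS Xmin] [F [[u0 FE] ->]].
have [x0 Qx0 _] := Q_tight ls g (@sub0set _ B) nested_set0.
have [x [Qx xv] xmin] := hpoly_min u0 Qx0 (@Q_ray eps s).
have Fx : F x by rewrite FE; split=> //; rewrite (support_argmin Qx xmin).
have [|z Xz zmin] := Xmin _ _ (active_nested ls g Qx); first by move=> J [].
exists z => // u /(_ x Fx) ux.
have umin y : Q eps s y -> dot u x <= dot u y.
  move=> Qy; have [M HM] := bdS (- u); rewrite ux.
  apply: (support_le (b := - M)) => // y' /QP[Sy' _].
  by have := HM y' Sy'; rewrite dotNl lerNl.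
rewrite (support_argmin Xz) //.
apply: (normal_cone_min Qx (nondeg_Q g Qx) umin Xz).
  by move=> y Xy; apply: sub_diff; exact: XS.
move=> p y; rewrite mem_cat => /orP[/mapP[G fG ->]|/mapP[J Js ->]].
  by rewrite (act_atom_Q ls g Qx fG).
rewrite act_cut => /eqP xJ Xy; have := zmin J y.
rewrite lerD2r; apply=> //; split=> //.
exact/(mem_listing J ls).
Qed.

Lemma vertex_cone eps s x : gapped eps s ->
  hvertex W o (constraints eps s) x ->
  normal_fan (Q eps s) (normal_cone (Q eps s) [set x]).
Proof.
by move=> g xv; exists [set x]; split=> //; apply/hvertexP => //; exact: Q_ray.
Qed.

Lemma mem_vertex_cone eps s x u : Q eps s x ->
  (forall y, Q eps s y -> dot u x <= dot u y) ->
  normal_cone (Q eps s) [set x] u.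
Proof. by move=> Qx umin _ ->; rewrite (support_argmin Qx umin). Qed.

Lemma lin_vertex_cone eps s x l : Q eps s x ->
  (forall v, v \in W -> dot l v = 0) -> normal_cone (Q eps s) [set x] l.
Proof.
move=> Qx l0; apply: mem_vertex_cone => // y Qy.
by rewrite -subr_ge0 -dotBr l0 //; exact: hpoly_diff Qy Qx.
Qed.

Lemma act_min eps s x p y : Q eps s x -> p \in constraints eps s ->
  act x p -> Q eps s y -> dot p.1 x <= dot p.1 y.
Proof. by move=> _ pD /eqP-> [_ /(_ p pD)]. Qed.

(** At a vertex minimizing [u], the expansion of [u] into some [u_ J] and a functional orthogonal to
    [W] takes place inside a single cone, where [f] and [g] are linear. *)
Lemma PL_ext eps s (f g : V -> R) : inclusion_listing B s -> gapped eps s ->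
  PL (normal_fan (Q eps s)) f -> PL (normal_fan (Q eps s)) g ->
  (forall J, B J -> f (u_ J) = g (u_ J)) ->
  (forall l, (forall v, v \in W -> dot l v = 0) -> f l = g l) -> f = g.
Proof.
move=> ls gs PLf PLg fgB fgl; apply/funext => u.
have [x0 Qx0 _] := Q_tight ls gs (@sub0set _ B) nested_set0.
have [x xv xmin] := hpoly_min u Qx0 (@Q_ray eps s);
  have Qx : Q eps s x by case: xv.
have [c [l [c0 l0 uE]]] := normal_decomp Qx (nondeg_Q gs Qx) xmin.
have C := vertex_cone gs xv; have [a fa] := PLf _ C; have [b gb] := PLg _ C.
have Cu := mem_vertex_cone Qx xmin; have Cl := lin_vertex_cone Qx l0.
rewrite (fa _ Cu) (gb _ Cu) uE !dotDl -(fa _ Cl) -(gb _ Cl) fgl // !dot_suml.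
congr (_ + _); rewrite big_seq_cond [RHS]big_seq_cond.
apply: eq_bigr => p /andP[]; rewrite mem_undup => pD xp; rewrite !dotZl.
have Cp : normal_cone (Q eps s) [set x] p.1.
  by apply: mem_vertex_cone => // y; exact: act_min.
rewrite -(fa _ Cp) -(gb _ Cp); congr (_ * _).
move: pD xp; rewrite mem_cat => /orP[/mapP[G fG ->]|/mapP[J Js ->] _].
  by rewrite (act_atom_Q ls gs Qx fG).
by apply: fgB; apply/(mem_listing J ls).
Qed.

Lemma PL_homogeneous eps s (f : V -> R) k u : inclusion_listing B s ->
  gapped eps s -> PL (normal_fan (Q eps s)) f -> 0 < k ->
  f (k *: u) = k * f u.
Proof.
move=> ls gs PLf k0.
have [x0 Qx0 _] := Q_tight ls gs (@sub0set _ B) nested_set0.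
have [x xv xmin] := hpoly_min u Qx0 (@Q_ray eps s);
  have Qx : Q eps s x by case: xv.
have [a fa] := PLf _ (vertex_cone gs xv).
rewrite (fa u) ?(fa (k *: u)) ?dotZl //; apply: mem_vertex_cone => // y Qy.
by rewrite !dotZl ler_pM2l // xmin.
Qed.

(** The cone of a vertex spans the dual space, so a vector can be recovered, coordinate by
    coordinate, from its products with that cone. *)
Lemma cone_diff eps s x u : gapped eps s ->
  hvertex W o (constraints eps s) x ->
  exists c, normal_cone (Q eps s) [set x] c.1 /\
    normal_cone (Q eps s) [set x] c.2 /\ u = c.1 - c.2.
Proof.
move=> gs xv; have Qx : Q eps s x by case: xv.
have [c [l [l0 uE]]] := vertex_decomp u xv (nondeg_Q gs Qx).
pose pos (d : V * R -> R) :=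
  \sum_(p <- undup (constraints eps s) | act x p) d p *: p.1.
have posC d y : (forall p,
  0 <= d p) -> Q eps s y -> dot (pos d) x <= dot (pos d) y.
  move=> d0 Qy; rewrite /pos !dot_suml big_seq_cond [leRHS]big_seq_cond.
  apply: ler_sum => p /andP[]; rewrite mem_undup => pD xp.
  by rewrite !dotZl ler_wpM2l //; exact: act_min Qx pD xp Qy.
pose c1 p := Num.max 0 (c p); pose c2 p := Num.max 0 (- c p).
have c1_ge0 p : 0 <= c1 p by rewrite le_max lexx.
have c2_ge0 p : 0 <= c2 p by rewrite le_max lexx.
exists (l + pos c1, pos c2) => /=; split; [|split].
- apply: mem_vertex_cone => // y Qy; rewrite !dotDl lerD ?posC //.
  by rewrite -subr_ge0 -dotBr l0 //; exact: hpoly_diff Qy Qx.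
- by apply: mem_vertex_cone => // y Qy; exact: posC.
rewrite uE -addrA -sumrB; congr (_ + _); apply: eq_bigr => p _.
rewrite -scalerBl; congr (_ *: _); rewrite /c1 /c2.
by case: (leP 0 (c p)) => [cp|cp]; case: leP; lra.
Qed.

(** * An open set of truncations inside the deep cone *)

Lemma truncationP P : truncation S nu B P <-> exists s eps,
  [/\ inclusion_listing B s, gapped eps s & P = Q eps s].
Proof.
have ps s : inclusion_listing B s -> forall F, F \in s -> proper_face S F.
  by move=> ls F /(mem_listing F ls)/properB.
have asE eps s : inclusion_listing B s ->
    all_shallow S nu eps S s <-> gapped eps s.
  move=> ls; have := @all_shallowP eps [::] s (gapped0 _) (ps s ls).
  by rewrite Q_nil.
have trE eps s : gapped eps s -> truncate S nu eps S s = Q eps s.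
  by move=> gs; have := @truncate_Q eps [::] s gs; rewrite Q_nil.
split=> -[s [eps [ls]]].
  by move=> /(asE eps s ls) gs ->; exists s, eps; rewrite trE.
by move=> gs ->; exists s, eps; rewrite trE //; split=> //; apply/asE.
Qed.

Lemma support_orth (X : set V) x l : X `<=` S -> X x ->
  (forall v, v \in W -> dot l v = 0) -> support X l = dot l o.
Proof.
move=> XS Xx l0; have E y : X y -> dot l y = dot l o.
  move=> /XS Sy; apply/eqP; rewrite -subr_eq0 -dotBr l0 //.
  exact: sub_diff.
by rewrite (support_argmin Xx) ?E // => y Xy; rewrite !E.
Qed.

(** Dividing [u] by it lands in the cube of [full_dimensional]; the summand 1 keeps it positive at
    [u = 0]. *)
Definition cube_scale (u : V) : R := 1 + \sum_i `|u 0 i|.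

Lemma cube_scale_gt0 u : 0 < cube_scale u.
Proof. by rewrite ltr_pwDl // sumr_ge0. Qed.

Lemma PL_bound eps s (f g : V -> R) e u : inclusion_listing B s ->
  gapped eps s -> PL (normal_fan (Q eps s)) f ->
  PL (normal_fan (Q eps s)) g ->
  (forall w : V, (forall i, `|w 0 i| <= 1) -> `|g w - f w| < e) ->
  `|g u - f u| <= cube_scale u * e.
Proof.
move=> ls gs PLf PLg near_fg; have K0 := cube_scale_gt0 u.
have uE : u = cube_scale u *: ((cube_scale u)^-1 *: u).
  by rewrite scalerA divff ?gt_eqF // scale1r.
rewrite {1 2}uE (PL_homogeneous _ ls gs PLf K0) (PL_homogeneous _ ls gs PLg K0).
rewrite -mulrBr normrM gtr0_norm // ler_pM2l //; apply/ltW/near_fg => i.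
rewrite mxE normrM gtr0_norm ?invr_gt0 // mulrC ler_pdivrMr // mul1r.
by rewrite /cube_scale (bigD1 i) //= addrCA lerDl addr_ge0 // sumr_ge0.
Qed.

Lemma fsum_listing s (h : set V -> R) : inclusion_listing B s ->
  \sum_(F \in B) h F = \sum_(F <- s) h F.
Proof. by move=> [us <- _]; rewrite -fsbig_seq. Qed.

(** With coefficient [q F / delta_ F], the deep truncation at [F] contributes exactly [q F] at each
    [u_ J] with [J] inside [F]. The coefficient of [S] brings the total to 1, so that heights and
    the values orthogonal to [W] agree as well. *)
Lemma truncation_in_deep a b r s eps s1 eps1 v :
  inclusion_listing B s -> in_box a b eps s -> gapped eps s ->
  (forall F, F \in s -> 0 < a F < b F) -> 0 < r ->
  (forall t1 F t2, s = t1 ++ F :: t2 -> \sum_(G <- t2) b G + r <= a F) ->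
  \sum_(F <- s) b F / delta_ F + r <= 1 ->
  inclusion_listing B s1 -> gapped eps1 s1 ->
  PL (normal_fan (Q eps1 s1)) (fun u => support (Q eps s) u + dot u v) ->
  T_deep S nu B (fun u => support (Q eps s) u + dot u v).
Proof.
move=> ls in_ab gs ab r_gt0 abr r1 ls1 gs1 PLf.
have memB J := mem_listing J ls.
have eps_b F : F \in s -> eps F <= b F by move=> /in_ab/andP[_ /ltW].
have [J1 J2 J3 J4|F Fs|t1 F t2 sE|q [q_bd qE]] := @triangular _ _ s eps.
- by move=> J5; exact: listing_after ls J5.
- by have /andP[a0 _] := ab F Fs; have /andP[aF _] := in_ab F Fs;
  exact: lt_trans aF.
- have Fs : F \in s by rewrite sE mem_cat mem_head orbT.
  have /andP[aF _] := in_ab F Fs; have := abr t1 F t2 sE.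
  have : \sum_(G <- t2) eps G <= \sum_(G <- t2) b G.
    rewrite big_seq [leRHS]big_seq; apply: ler_sum => G Gt; apply: eps_b.
    by rewrite sE mem_cat inE Gt !orbT.
  by lra.
have dB F : F \in s -> 0 < delta_ F by move=> /memB/properB/delta_gt0.
have sum_lt1 : \sum_(F <- s) q F / delta_ F < 1.
  have : \sum_(F <- s) q F / delta_ F <= \sum_(F <- s) b F / delta_ F.
    rewrite big_seq [leRHS]big_seq; apply: ler_sum => F Fs.
    apply: ler_wpM2r; first by rewrite invr_ge0 ltW // dB.
    by have /andP[_ qF] := q_bd F Fs; exact: le_trans qF (eps_b F Fs).
  by lra.
exists (1 - \sum_(F <- s) q F / delta_ F), (fun F => q F / delta_ F), v; split.
- by rewrite subr_gt0.
- by move=> F /memB Fs; have /andP[q0 _] := q_bd F Fs; rewrite divr_gt0 // dB.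
apply: (PL_ext ls1 gs1 PLf) => [C GC|J BJ|l l0].
- have [zS SzS zSE] := fan_linear ls1 gs1 nested_minima_S GC.
  (* For each deep truncation, a vector representing its support function on [C]; outside [B] the
     value is a dummy. *)
  have [F|z zP] := @choice (set V) V (fun F w => B F -> forall u, C u ->
      support (DTr S F (u_ F)) u = dot u w).
    have [BF|nBF] := pselect (B F); last by exists 0.
    by have [w _ wE] := fan_linear ls1 gs1 (nested_minima_DTr BF) GC; exists w.
  exists ((1 - \sum_(F <- s) q F / delta_ F) *: zS +
    \sum_(F <- s) (q F / delta_ F) *: z F + v) => u Cu.
  rewrite !dotDr dotZr -zSE // dot_sumr (fsum_listing _ ls); congr (_ + _ + _).
  rewrite !big_seq; apply: eq_bigr => F /memB BF.
  by rewrite dotZr (zP F BF u Cu).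
- rewrite (support_Q ls gs BJ) (support_S BJ) (fsum_listing _ ls) qE;
  last exact/memB.
  congr (_ + _); set c := \sum_(F <- s) _ / _.
  have -> : \sum_(F <- s) q F / delta_ F * support (DTr S F (u_ F)) (u_ J) =
      c * height J + \sum_(I <- s | `[< J `<=` I >]) q I.
    rewrite /c big_distrl (big_mkcond (fun I => `[< J `<=` I >])) -big_split /=.
    rewrite !big_seq; apply: eq_bigr => F Fs; rewrite support_DTr //;
      last exact/memB.
    rewrite mulrDr; congr (_ + _); case: asboolP => _; last by rewrite mulr0.
    by rewrite divfK // gt_eqF // dB.
  by ring.
- have [x Qx _] := Q_tight ls gs (@sub0set _ B) nested_set0.
  rewrite (support_orth (x := x)) //; last by move=> y /QP[].
  rewrite (support_orth (x := o) _ So l0) // (fsum_listing _ ls).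
  congr (_ + _); set c := \sum_(F <- s) _ / _.
  have -> : \sum_(F <- s) q F / delta_ F * support (DTr S F (u_ F)) l =
      c * dot l o.
    rewrite /c big_distrl /= !big_seq; apply: eq_bigr => F /memB BF.
    have [z [Sz zF _]] := deep_point BF (@sub0set _ B) nested_set0.
    congr (_ * _); apply: (support_orth (x := z)) => //.
      by move=> y /(DTrP y BF)[].
    exact/(DTrP z BF).
  by ring.
Qed.

Lemma building_full_dimensional : finite_set B ->
  full_dimensional (PL (Gamma S nu B)) (T_deep S nu B `&` T_trunc S nu B).
Proof.
move=> finB; have [s ls] := listing_exists finB.
have memB J := mem_listing J ls.
have [a [b [m [r [_ r_gt0 ab abP [abr r1]]]]]] :=
  @box s s [::] ls (esym (cats0 s)).
have box_gapped eps : in_box a b eps s -> gapped eps s by move=> /abP[].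
pose eps0 F := (a F + b F) / 2.
have in0 : in_box a b eps0 s.
  by move=> F /ab/andP[aF bF]; rewrite /eps0; apply/andP; split; lra.
have g0 := box_gapped _ in0.
(* The truncation behind [Gamma] has a listing and depths of its own; all comparisons take place on
   its fan. *)
have [s1 [eps1 [ls1 gs1 GE]]] : exists s1 eps1, [/\ inclusion_listing B s1,
    gapped eps1 s1 & xget set0 (truncation S nu B) = Q eps1 s1].
  apply/truncationP; apply: xgetPex; exists (Q eps0 s).
  by apply/truncationP; exists s, eps0.
rewrite /Gamma GE.
have trunc_PL eps t c v : inclusion_listing B t -> gapped eps t ->
    PL (normal_fan (Q eps1 s1)) (fun u => c * support (Q eps t) u + dot u v).
  move=> lt gt C GC.
  have [z Xz zE] := fan_linear ls1 gs1 (nested_minima_Q lt gt) GC.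
  by exists (c *: z + v) => u Cu; rewrite zE // dotDr dotZr.
have mul1E eps v : (fun u => 1 * support (Q eps s) u + dot u v) =
    (fun u => support (Q eps s) u + dot u v).
  by apply/funext => u; rewrite mul1r.
have boxX eps v : in_box a b eps s -> (T_deep S nu B `&` T_trunc S nu B)
    (fun u => support (Q eps s) u + dot u v).
  move=> in_ab; have gs := box_gapped _ in_ab; split; last first.
    exists 1, (Q eps s), v; split; first exact: ltr01.
      by apply/truncationP; exists s, eps.
    by rewrite mul1E.
  apply: (truncation_in_deep ls in_ab gs ab r_gt0 abr r1 ls1 gs1).
  by rewrite -mul1E; exact: trunc_PL.
split.
  move=> _ [_ [c [P [v [c0 /truncationP[t [e [lt gt ->]]] ->]]]]].
  exact: trunc_PL.
pose f0 u := support (Q eps0 s) u + dot u 0.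
have PLf0 : PL (normal_fan (Q eps1 s1)) f0 by rewrite /f0 -mul1E;
  exact: trunc_PL.
have [x0 Qx0 _] := Q_tight ls1 gs1 (@sub0set _ B) nested_set0.
have [x xv _] := hpoly_min 0 Qx0 (@Q_ray eps1 s1).
have Qx : Q eps1 s1 x by case: xv.
have GC := vertex_cone gs1 xv; set C := normal_cone _ _ in GC.
have [y0 y0E] := PLf0 _ GC.
have [i|d dP] := @choice 'I_n (V * V)%type (fun i c => C c.1 /\ C c.2 /\
    delta_mx 0 i = c.1 - c.2); first exact: cone_diff.
(* Per unit of [e], a bound on the change of the depth of [J]: the first term is for [g - f0] at
   [u_ J], the second for the translation [v], whose coordinates are differences of values on
   [C]. *)
pose K J := cube_scale (u_ J) + \sum_i `|(u_ J) 0 i| *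
  (cube_scale (d i).1 + cube_scale (d i).2).
have K_gt0 J : 0 < K J.
  rewrite ltr_pwDl ?cube_scale_gt0 // sumr_ge0 // => i _.
  by rewrite mulr_ge0 // addr_ge0 // ltW // cube_scale_gt0.
have [J /ab/andP[_ bJ]|e e_gt0 eP] := @seq_eps R _ s
    (fun J t => K J * t < (b J - a J) / 2).
  exists ((b J - a J) / 4 / K J); first by rewrite !divr_gt0 //; lra.
  move=> t /andP[_]; rewrite ler_pdivlMr // mulrC; lra.
exists f0, e; split=> //; first exact: boxX.
move=> g PLg near_g.
have bound u : `|g u - f0 u| <= cube_scale u * e.
  exact: (PL_bound _ ls1 gs1 PLf0 PLg near_g).
(* Depths have no effect on functionals orthogonal to [W], so there [g - f0] must come from a
   translation. The cone [C] contains them all, and [v] is the linear function that [g - f0] is on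
   [C]. *)
have [z zE] := PLg _ GC; pose v := z - y0.
have vE u : C u -> dot u v = g u - f0 u by move=> Cu; rewrite dotBr -zE // -y0E.
have v_le i : `|v 0 i| <= (cube_scale (d i).1 + cube_scale (d i).2) * e.
  have [C1 [C2 dE]] := dP i; rewrite -dot_delta dE dotBl !vE // mulrDl.
  by apply: le_trans (ler_normB _ _) _; rewrite lerD.
pose eps' J := g (u_ J) - dot (u_ J) v - height J.
have in' : in_box a b eps' s.
  move=> J Js; have BJ : B J by exact/memB.
  have f0J : f0 (u_ J) = height J + eps0 J by rewrite /f0 dot0r addr0
    (support_Q ls g0).
  have : `|eps' J - eps0 J| < (b J - a J) / 2.
    have -> : eps' J - eps0 J = (g (u_ J) - f0 (u_ J)) - dot (u_ J) v.
      by rewrite f0J /eps'; ring.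
    apply: le_lt_trans (eP J e Js _); last by rewrite lexx ltW.
    apply: le_trans (ler_normB _ _) _; rewrite /K mulrDl lerD //.
    rewrite /dot big_distrl /=; apply: le_trans (ler_norm_sum _ _ _) _.
    by apply: ler_sum => i _; rewrite normrM -mulrA ler_wpM2l.
  by rewrite ltr_norml /eps0 => /andP[? ?]; apply/andP; split; lra.
have g' := box_gapped _ in'.
suff -> : g = fun u => support (Q eps' s) u + dot u v by exact: boxX.
apply: (PL_ext ls1 gs1 PLg).
- by rewrite -mul1E; exact: trunc_PL.
- by move=> J BJ; rewrite (support_Q ls g' BJ) /eps'; ring.
- move=> l l0; rewrite vE; last exact: lin_vertex_cone.
  have [x1 Qx1 _] := Q_tight ls g' (@sub0set _ B) nested_set0.
  have [x2 Qx2 _] := Q_tight ls g0 (@sub0set _ B) nested_set0.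
  rewrite (support_orth (x := x1)) //; last by move=> y /QP[].
  rewrite /f0 dot0r (support_orth (x := x2)) //; last by move=> y /QP[].
  by ring.
Qed.

End BuildingSet.

End Truncations.

Theorem proposition5p13 (R : realType) (n : nat) (S : set 'rV[R]_n)
    (nu : set 'rV[R]_n -> 'rV[R]_n) (B : set (set 'rV[R]_n))
    (simpleS : simple_polytope S) (normalsS : facet_normals S nu)
    (buildB : building_set S B) :
  full_dimensional (PL (Gamma S nu B))
    (T_deep S nu B `&` T_trunc S nu B).
Proof.
have [W [o [fs [ufs fsE SE So nd]]]] := simple_presentation simpleS normalsS.
have [polyS _] := simpleS.
have bd := polytope_bounded polyS.
apply: (building_full_dimensional ufs _ SE So nd (bounded_ray_free bd) bd) =>
  //.
- by move=> G; have := congr1 (fun A => A G) fsE => /= ->.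
- by move=> G /normalsS[].
- apply: sub_finite_set (finite_faces polyS) => F BF.
  by case: buildB => /(_ F BF)[].
Qed.
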